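(* A left linearly compact semisimple topological ring is minimal if and only if it has no direct summands of the form $M(n,\Delta)$ (with $n$ a positive integer), where $\Delta$ is a division ring which admits a nondiscrete Hausdorff ring topology.
   Context: Rings are associative. A ring topology is a topology for which addition, negation and multiplication are (jointly) continuous; all topologies considered are Hausdorff. Semisimple means that the Jacobson radical is zero. A topological ring is left linearly compact if it is Hausdorff, has a fundamental system of neighborhoods of zero consisting of left ideals, and every family of closed cosets of left ideals having the finite intersection property has nonempty intersection. $M(n,\Delta)$ is the ring of $n\times n$ matrices over $\Delta$; a direct summand of a ring is a two-sided ideal which is a direct summand as a ring. A topological ring $(R,\mathcal T)$ is minimal if there is no (Hausdorff) ring topology $\mathcal U$ on $R$ with $\mathcal U\leq\mathcal T$ (i.e. $\mathcal U$ coarser than $\mathcal T$) and $\mathcal U\neq\mathcal T$. *)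

(* Defs.v *)
From HB Require Import structures.
From mathcomp Require Import all_boot all_order all_algebra.
From mathcomp Require Import all_classical topology.

Set Implicit Arguments.
Unset Strict Implicit.
Unset Printing Implicit Defensive.

Import GRing.Theory.

Local Open Scope classical_set_scope.
Local Open Scope ring_scope.

(* pzRingType and its descendants presuppose an identity element; here a ring
   is only assumed to be associative. *)
HB.mixin Record Zmodule_isRng R & GRing.Zmodule R := {
  rmul : R -> R -> R;
  rmulA : associative rmul;
  rmulDl : left_distributive rmul +%R;
  rmulDr : right_distributive rmul +%R
}.

#[short(type="rngType")]
HB.structure Definition Rng := {R of Zmodule_isRng R & GRing.Zmodule R}.

Notation "x ** y" := (rmul x y) (at level 40, left associativity) : ring_scope.

Section Ideals.
Variable R : rngType.
Implicit Types (I J L M : set R).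

Definition additive_subgroup L : Prop :=
  L 0 /\ (forall x y, L x -> L y -> L (x - y)).

Definition left_ideal L : Prop :=
  additive_subgroup L /\ (forall r x, L x -> L (r ** x)).

Definition two_sided_ideal I : Prop :=
  left_ideal I /\ (forall r x, I x -> I (x ** r)).

Definition direct_summand I : Prop :=
  two_sided_ideal I /\
  exists J, [/\ two_sided_ideal J, I `&` J = [set 0] &
    forall x, exists i j, [/\ I i, J j & x = i + j]].

(* Modularity (regularity) is automatic when R has an identity. *)
Definition modular L : Prop := exists e, forall x, L (x - x ** e).

Definition maximal_left_ideal L : Prop :=
  [/\ left_ideal L, L <> setT &
    forall M, left_ideal M -> L `<=` M -> M = L \/ M = setT].

(* The intersection of the empty family is R itself. *)
Definition jacobson_radical : set R :=
  \bigcap_(L in [set L | maximal_left_ideal L /\ modular L]) L.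

Definition semisimple : Prop := jacobson_radical = [set 0].

End Ideals.

Arguments semisimple : clear implicits.

(* A topology on the type R is an element T of the class [Topological R], and
   [Topological.Pack T] is R viewed as a topological space through T; this is
   what allows several topologies on one ring to be compared. *)
Section Topologies.
Variable R : Type.
Implicit Types T U : Topological R.

Definition hausdorff T : Prop := hausdorff_space (Topological.Pack T).

Definition discrete T : Prop := forall A, @open (Topological.Pack T) A.

Definition coarser U T : Prop :=
  @open (Topological.Pack U) `<=` @open (Topological.Pack T).

(* Equality of the open sets, not of the class records, which also carry
   decidable equality and choice operators. *)
Definition same_topology U T : Prop :=
  @open (Topological.Pack U) = @open (Topological.Pack T).

End Topologies.

(* The multiplication is a parameter so that the definition applies both to
   rngType and to pzRingType. *)
Definition ring_topology (R : zmodType) (mul : R -> R -> R)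
    (T : Topological R) : Prop :=
  let X := Topological.Pack T in
  [/\ continuous (fun p : X * X => (p.1 : R) + (p.2 : R) : X),
      continuous (fun x : X => - (x : R) : X) &
      continuous (fun p : X * X => mul p.1 p.2 : X)].

Section TopologicalRings.
Variable R : rngType.
Implicit Types T U : Topological R.

Definition left_linear T : Prop :=
  forall V : set R, @nbhs _ (Topological.Pack T) 0 V ->
  exists L : set R,
    [/\ left_ideal L, @nbhs _ (Topological.Pack T) 0 L & L `<=` V].

Definition closed_left_coset T (C : set R) : Prop :=
  @closed (Topological.Pack T) C /\
  exists x (L : set R), left_ideal L /\ C = [set x + y | y in L].

Definition left_linearly_compact T : Prop :=
  [/\ hausdorff T, left_linear T &
    forall F : set (set R), F `<=` closed_left_coset T ->
      finI F id -> \bigcap_(C in F) C !=set0].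

Definition minimal_ring_topology T : Prop :=
  forall U : Topological R,
    hausdorff U -> ring_topology rmul U -> coarser U T -> same_topology U T.

End TopologicalRings.

Definition division_ring (D : nzRingType) : Prop :=
  forall x : D, x != 0 -> exists y, x * y = 1 /\ y * x = 1.

Definition admits_nondiscrete_topology (D : nzRingType) : Prop :=
  exists T : Topological D,
    [/\ hausdorff T, ring_topology *%R T & ~ discrete T].

Definition isomorphic_to_matrix_ring (R : rngType) (I : set R)
    (n : nat) (D : nzRingType) : Prop :=
  exists f : 'M[D]_n -> R,
    [/\ injective f, range f = I, {morph f : A B / A + B} &
        {morph f : A B / A *m B >-> A ** B}].

(* Main.v *)
From HB Require Import structures.
Require Import Defs.
From mathcomp Require Import all_boot all_order all_algebra.
From mathcomp Require Import finmap all_classical topology.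

Set Implicit Arguments.
Unset Strict Implicit.
Unset Printing Implicit Defensive.

Import GRing.Theory.

Local Open Scope classical_set_scope.
Local Open Scope ring_scope.

(** A ring topology is known from its filter of neighbourhoods of 0, so
    everything is said about such filters: N for the linearly compact topology
    T, and N' for another ring topology, coarser when N' is contained in N.

    The structure of R.  Linear compactness forbids an infinite direct sum
    inside a quotient of R by an open left ideal ([no_infinite_chain]).  Since
    the radical is zero, the open maximal modular left ideals have intersection
    zero ([open_maximal_sep]), and therefore every open left ideal contains a
    finite intersection of them ([open_ideal_contains_cap]).  Each of them is
    the left annihilator of an idempotent e for which Re is a minimal left
    ideal and eRe a division ring ([open_maximal_minimal_idempotent],
    [corner_division]).  So T is the topology of pointwise convergence for the
    action of R on its minimal left ideals Re, and a coarser ring topology is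
    equal to T as soon as all the [left_ann e] are neighbourhoods of 0 in it.

    No bad summand implies minimal.  For an open left ideal L, the subspace of
    Re killed by L has finite dimension over eRe ([dual_basis]).  If no open
    left ideal kills the whole of Re, then Re has infinite dimension, and the
    continuity of the product already forces [left_ann e] to be a
    neighbourhood of 0 in every coarser Hausdorff ring topology: a
    neighbourhood W with W W e avoiding e contains an open L, so W sends e into
    the proper subspace killed by L, and finitely many left multiplications
    shrink that subspace to 0 ([ann_nbhs_unbounded]).  If some open left ideal
    kills Re, then Re is finite dimensional and a dual basis provides matrix
    units: ReR is a direct summand isomorphic to a matrix ring over eRe.  The
    coarser topology induces a Hausdorff ring topology on eRe, which has to be
    discrete, and [left_ann e] is again a neighbourhood of 0
    ([ann_nbhs_bounded]).

    A bad summand prevents minimality.  On a direct summand M(n, D) the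
    topology T is discrete ([summand_discrete]).  Replacing it there by the
    entrywise topology coming from a nondiscrete topology of D, and keeping T
    on the complement, gives a strictly coarser ring topology
    ([matrix_summand_not_minimal]). *)

(** * Ring topologies as filters of neighbourhoods of zero *)

Record ring_filter (R : zmodType) (mul : R -> R -> R) (N : set_system R) :
    Prop := RingFilter {
  rf_filter : Filter N;
  rf_zero : forall V, N V -> V 0;
  rf_sub : forall V, N V ->
    exists2 W, N W & forall x y, W x -> W y -> V (x - y);
  rf_mul : forall V, N V ->
    exists2 W, N W & forall x y, W x -> W y -> V (mul x y);
  rf_mull : forall a V, N V -> N [set x | V (mul a x)];
  rf_mulr : forall a V, N V -> N [set x | V (mul x a)];
  rf_sep : forall x, (forall V, N V -> V x) -> x = 0
}.

Definition nbhs0 (R : zmodType) (T : Topological R) : set_system R :=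
  @nbhs _ (Topological.Pack T) 0.

Section TopologyToFilter.
Variables (R : zmodType) (mul : R -> R -> R) (T : Topological R).
Hypotheses (mulDl : left_distributive mul +%R)
           (mulDr : right_distributive mul +%R).
Hypotheses (T_haus : hausdorff T) (T_ring : ring_topology mul T).

Let X := Topological.Pack T.

(** Translations are homeomorphisms, so the neighbourhoods of 0 determine the
    topology. *)
Lemma topology_nbhs_shift (x : R) (A : set R) :
  @nbhs _ X x A <-> nbhs0 T [set y | A (x + y)].
Proof.
have [addc _ _] := T_ring; split => xA.
- have /= := addc ((x, 0) : X * X) A; rewrite addr0 => /(_ xA) [[B C]] /= [xB C0] BC.
  apply: (filterS (P := C)) C0 => y Cy.
  by apply: (BC (x, y)); split => //; exact: (@nbhs_singleton X _ _ xB).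
- have /= := addc ((- x, x) : X * X) [set y | A (x + y)].
  rewrite addNr => /(_ xA) [[B C]] /= [xB C0] BC.
  apply: (filterS (P := C)) C0 => y Cy.
  have := BC (- x, y); rewrite /= addNKr; apply; split => //.
  exact: (@nbhs_singleton X _ _ xB).
Qed.

Let mul0 a : mul a 0 = 0.
Proof. by apply: (addrI (mul a 0)); rewrite -mulDr !addr0. Qed.

Let mul0l a : mul 0 a = 0.
Proof. by apply: (addrI (mul 0 a)); rewrite -mulDl !addr0. Qed.

Lemma ring_topology_filter : ring_filter mul (nbhs0 T).
Proof.
have [addc oppc mulc] := T_ring; split.
- exact: (@nbhs_filter X).
- by move=> V; exact: (@nbhs_singleton X).
- move=> V V0.
  have /= := addc ((0, 0) : X * X) V; rewrite addr0 => /(_ V0) [[B C]] /= [B0 C0] BC.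
  have /= := oppc 0 C; rewrite oppr0 => /(_ C0) C0'.
  exists (B `&` [set x | C (- x)]); first exact: (@filterI X).
  by move=> x y [Bx _] [_ Cy]; exact: (BC (x, - y)).
- move=> V V0.
  have /= := mulc ((0, 0) : X * X) V; rewrite mul0 => /(_ V0) [[B C]] /= [B0 C0] BC.
  exists (B `&` C); first exact: (@filterI X).
  by move=> x y [Bx _] [_ Cy]; exact: (BC (x, y)).
- move=> a V V0.
  have /= := mulc ((a, 0) : X * X) V; rewrite mul0 => /(_ V0) [[B C]] /= [B0 C0] BC.
  apply: (filterS (P := C)) C0 => y Cy.
  by apply: (BC (a, y)); split => //; exact: (@nbhs_singleton X _ _ B0).
- move=> a V V0.
  have /= := mulc ((0, a) : X * X) V; rewrite mul0l => /(_ V0) [[B C]] /= [B0 C0] BC.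
  apply: (filterS (P := B)) B0 => y By.
  by apply: (BC (y, a)); split => //; exact: (@nbhs_singleton X _ _ C0).
- move=> x xV; apply/esym; apply: (T_haus (p := 0) (q := x)) => A B A0 Bx.
  by exists x; split; [exact: xV | exact: (@nbhs_singleton X _ _ Bx)].
Qed.

Lemma discrete_nbhs0 : discrete T <-> nbhs0 T [set 0].
Proof.
split=> [dT|T0 A].
  by apply: (@open_nbhs_nbhs X); split => //; exact: dT.
rewrite openE => x Ax; apply/topology_nbhs_shift.
apply: (@filterS X _ _ [set 0]) T0 => _ -> /=.
by rewrite addr0.
Qed.
End TopologyToFilter.

Section CompareTopologies.
Variables (R : zmodType) (mul : R -> R -> R) (T U : Topological R).
Hypotheses (T_ring : ring_topology mul T) (U_ring : ring_topology mul U).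

Lemma coarser_nbhs0 : coarser U T <-> nbhs0 U `<=` nbhs0 T.
Proof.
split=> [UT V|UT V].
  rewrite /nbhs0 !nbhsE => -[W [Wo W0] WV].
  by exists W => //; split => //; exact: UT.
rewrite !openE => Vo x /Vo Vx.
apply: (proj2 (topology_nbhs_shift T_ring x V)); apply: UT.
exact: (proj1 (topology_nbhs_shift U_ring x V) Vx).
Qed.
End CompareTopologies.

Lemma same_topology_nbhs0 (R : zmodType) (mul : R -> R -> R)
    (T U : Topological R) :
  ring_topology mul T -> ring_topology mul U ->
  same_topology U T <-> nbhs0 U = nbhs0 T.
Proof.
move=> T_ring U_ring; rewrite /same_topology; split=> UT; apply/seteqP.
  split; [apply/(coarser_nbhs0 T_ring U_ring)|apply/(coarser_nbhs0 U_ring T_ring)];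
  by rewrite /coarser UT.
split; [apply/(coarser_nbhs0 T_ring U_ring)|apply/(coarser_nbhs0 U_ring T_ring)];
  by rewrite UT.
Qed.

Section FilterToTopology.
Variables (R : zmodType) (mul : R -> R -> R) (N : set_system R).
Hypotheses (mulDl : left_distributive mul +%R)
           (mulDr : right_distributive mul +%R).
Hypothesis N_ring : ring_filter mul N.

Definition shifted_nbhs (x : R) : set_system R := [set A | N [set y | A (x + y)]].

#[local] Instance N_filter : Filter N := rf_filter N_ring.

Lemma shifted_nbhs_filter x : ProperFilter (shifted_nbhs x).
Proof.
split.
  by move=> /= /(rf_zero N_ring).
split.
- exact: filterT.
- by move=> A B; exact: filterI.
- by move=> A B AB; apply: filterS => y; exact: AB.
Qed.

Lemma shifted_nbhs_singleton x A : shifted_nbhs x A -> A x.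
Proof. by move=> /(rf_zero N_ring) /=; rewrite addr0. Qed.

Lemma rf_add V : N V -> exists2 W, N W & forall x y, W x -> W y -> V (x + y).
Proof.
move=> /(rf_sub N_ring) [W W0 WV]; have [Y Y0 YW] := rf_sub N_ring W0.
exists (W `&` Y); first exact: filterI.
move=> x y [Wx _] [_ Yy]; rewrite -[y]opprK; apply: WV => //.
by rewrite -sub0r; apply: YW => //; exact: (rf_zero N_ring).
Qed.

Lemma shifted_nbhs_nbhs x A :
  shifted_nbhs x A -> shifted_nbhs x (shifted_nbhs^~ A).
Proof.
move=> xA; have [W W0 WA] := rf_add xA.
apply: (@filterS _ N _ W _ _ W0) => y Wy.
apply: (@filterS _ N _ W _ _ W0) => z Wz.
by rewrite /= -addrA; exact: WA.
Qed.

Definition filter_nbhs_space : nbhsType :=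
  HB.pack_for nbhsType R (hasNbhs.Build R shifted_nbhs).

Definition filter_topology_space : topologicalType :=
  HB.pack_for topologicalType (Nbhs.sort filter_nbhs_space)
    (@Nbhs_isNbhsTopological.Build filter_nbhs_space shifted_nbhs_filter
      shifted_nbhs_singleton shifted_nbhs_nbhs).

Lemma ring_filter_topology : exists T : Topological R,
  [/\ hausdorff T, ring_topology mul T & nbhs0 T = N].
Proof.
exists (Topological.class filter_topology_space).
pose X := filter_topology_space.
have nE (x : R) A : @nbhs _ X x A = N [set y | A (x + y)] by [].
have nW (x : R) W : N W -> @nbhs _ X x [set z | W ((z : R) - x)].
  move=> NW; rewrite nE; apply: (@filterS _ N _ W _ _ NW) => z Wz /=.
  by rewrite addrAC subrr add0r.
split.
- move=> x y xy; apply/eqP; rewrite -subr_eq0; apply/eqP.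
  apply: (rf_sep N_ring) => V /(rf_sub N_ring) [W W0 WV].
  have [z [Wx Wy]] := xy _ _ (nW x _ W0) (nW y _ W0).
  by have := WV _ _ Wy Wx; rewrite opprB addrC addrA subrK.
- split.
  + move=> [x y] A /rf_add [W W0 WA].
    exists ([set z | W ((z : R) - x)], [set z | W ((z : R) - y)]).
      by split; exact: nW.
    move=> [z t] /= [Wz Wt]; have := WA _ _ Wz Wt.
    by rewrite /= addrACA ![_ + (_ - _)]addrC !subrK.
  + move=> x A /(rf_sub N_ring) [W W0 WA].
    apply: (@filterS _ (@nbhs _ X x) _ _ _ _ (nW x _ W0)) => z /= Wz.
    have := WA _ _ (rf_zero N_ring W0) Wz.
    by rewrite /= sub0r opprB addrA addNr add0r.
  + move=> [x y] A /rf_add [W1 W10 W1A]; have [W2 W20 W21] := rf_add W10.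
    have [W3 W30 W32] := rf_mul N_ring W10.
    have := rf_mull N_ring x W20; have := rf_mulr N_ring y W20.
    move=> Wy Wx; pose W4 := [set a | W2 (mul a y)] `&` W3.
    pose W5 := [set b | W2 (mul x b)] `&` W3.
    exists ([set z | W4 ((z : R) - x)], [set z | W5 ((z : R) - y)]).
      by split; apply: nW; exact: filterI.
    move=> [z t] /= [[]]; rewrite /preimage /=.
    (* With z = x + a and t = y + b, z t = x y + a y + x b + a b: the first two
       error terms are small because x and y are fixed, the last one because
       a and b are both small. *)
    have: z = x + (z - x) by rewrite addrC subrK.
    have: t = y + (t - y) by rewrite addrC subrK.
    move: (z - x) (t - y) => a b -> -> Wa1 Wa3 [Wb2 Wb3].
    have := W1A _ _ (W21 _ _ Wa1 Wb2) (W32 _ _ Wa3 Wb3).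
    by rewrite /= mulDl !mulDr [mul a y + _]addrC !addrA.
- by apply/funext => A; rewrite /nbhs0 nE; under eq_set do rewrite add0r.
Qed.

End FilterToTopology.

(** * Left ideals in a ring that may lack an identity *)

Section RngTheory.
Variable R : rngType.
Implicit Types (x y z r e w : R) (L M C P : set R).

Lemma rmulx0 x : x ** 0 = 0.
Proof. by apply: (addrI (x ** 0)); rewrite -rmulDr !addr0. Qed.

Lemma rmul0x x : 0 ** x = 0.
Proof. by apply: (addrI (0 ** x)); rewrite -rmulDl !addr0. Qed.

Lemma rmulxN x y : x ** - y = - (x ** y).
Proof. by apply: (addrI (x ** y)); rewrite -rmulDr !subrr rmulx0. Qed.

Lemma rmulNx x y : - x ** y = - (x ** y).
Proof. by apply: (addrI (x ** y)); rewrite -rmulDl !subrr rmul0x. Qed.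

Lemma rmulBr x y z : x ** (y - z) = x ** y - x ** z.
Proof. by rewrite rmulDr rmulxN. Qed.

Lemma rmulBl x y z : (x - y) ** z = x ** z - y ** z.
Proof. by rewrite rmulDl rmulNx. Qed.

Lemma rmul_suml I (s : seq I) (Q : pred I) (F : I -> R) x :
  (\sum_(i <- s | Q i) F i) ** x = \sum_(i <- s | Q i) F i ** x.
Proof.
by elim/big_ind2: _ => [|a b c d <- <-|//]; rewrite ?rmul0x ?rmulDl.
Qed.

Lemma rmul_sumr I (s : seq I) (Q : pred I) (F : I -> R) x :
  x ** (\sum_(i <- s | Q i) F i) = \sum_(i <- s | Q i) x ** F i.
Proof.
by elim/big_ind2: _ => [|a b c d <- <-|//]; rewrite ?rmulx0 ?rmulDr.
Qed.

Section LeftIdeal.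
Variables (L : set R).
Hypothesis L_ideal : left_ideal L.

Lemma ideal0 : L 0. Proof. by have [[]] := L_ideal. Qed.

Lemma idealB x y : L x -> L y -> L (x - y).
Proof. by have [[_ +] _] := L_ideal; apply. Qed.

Lemma idealN x : L x -> L (- x).
Proof. by move=> Lx; rewrite -sub0r; apply: idealB => //; exact: ideal0. Qed.

Lemma idealD x y : L x -> L y -> L (x + y).
Proof. by move=> Lx Ly; rewrite -[y]opprK; apply: idealB => //; exact: idealN. Qed.

Lemma idealM r x : L x -> L (r ** x).
Proof. by have [_] := L_ideal; apply. Qed.

Lemma ideal_sum I (s : seq I) (Q : pred I) (F : I -> R) :
  (forall i, Q i -> L (F i)) -> L (\sum_(i <- s | Q i) F i).
Proof. by move=> LF; elim/big_ind: _ => //; [exact: ideal0 | exact: idealD]. Qed.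

Lemma idealBr x y : L (x - y) -> L y -> L x.
Proof. by move=> Lxy Ly; rewrite -[x](subrK y); exact: idealD. Qed.

Lemma idealBl x y : L (x - y) -> L x -> L y.
Proof. by move=> Lxy Lx; rewrite -[y](subKr x); exact: idealB. Qed.
End LeftIdeal.

Lemma left_idealI L M : left_ideal L -> left_ideal M -> left_ideal (L `&` M).
Proof.
move=> Ll Ml; split; first split.
- by split; exact: ideal0.
- by move=> x y [? ?] [? ?]; split; exact: idealB.
- by move=> r x [? ?]; split; exact: idealM.
Qed.

Definition ideal_add L M : set R := [set x | exists2 a, L a & M (x - a)].

Lemma left_ideal_add L M : left_ideal L -> left_ideal M ->
  left_ideal (ideal_add L M).
Proof.
move=> Ll Ml; split; first split.
- by exists 0; rewrite ?subrr; exact: ideal0.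
- move=> x y [a La Ma] [b Lb Mb]; exists (a - b); first exact: idealB.
  have -> : x - y - (a - b) = x - a - (y - b).
    by rewrite !opprD !opprK addrACA.
  exact: idealB.
- move=> r x [a La Ma]; exists (r ** a); first exact: idealM.
  by rewrite -rmulBr; exact: idealM.
Qed.

Lemma ideal_addl L M : left_ideal M -> L `<=` ideal_add L M.
Proof. by move=> Ml x Lx; exists x => //; rewrite subrr; exact: ideal0. Qed.

Lemma ideal_addr L M : left_ideal L -> M `<=` ideal_add L M.
Proof. by move=> Ll x Mx; exists 0; [exact: ideal0 | rewrite subr0]. Qed.

Definition left_ann x : set R := [set r | r ** x = 0].

Lemma left_ideal_ann x : left_ideal (left_ann x).
Proof.
split; first split; rewrite /left_ann /=.
- exact: rmul0x.
- by move=> y z yx zx; rewrite rmulBl yx zx subrr.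
- by move=> r y yx; rewrite -rmulA yx rmulx0.
Qed.

Lemma maximal_add P M x : maximal_left_ideal P -> left_ideal M ->
  ~ (M `<=` P) -> exists2 m, M m & P (x - m).
Proof.
move=> [Pl _ Pmax] Ml MP.
have [PM|] := Pmax _ (left_ideal_add Ml Pl) (ideal_addr Ml).
  by case: MP; rewrite -PM; exact: ideal_addl.
by move=> MPT; have : [set: R] x by []; rewrite -MPT.
Qed.

(** Zorn's lemma; a left ideal containing M is proper exactly when it omits the
    modular unit e, and this condition survives unions of chains. *)
Lemma modular_maximal M e : left_ideal M -> (forall x, M (x - x ** e)) ->
  M <> setT -> exists P, [/\ maximal_left_ideal P, M `<=` P & ~ P e].
Proof.
move=> Ml Me MT.
have eT L : left_ideal L -> M `<=` L -> L e -> L = setT.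
  move=> Ll ML Le; apply/seteqP; split => // x _.
  by apply: (idealBr Ll (ML _ (Me x))); exact: idealM.
(* Adjoining M to every member keeps the union of the empty chain a left
   ideal. *)
pose Q := [set A | left_ideal (M `|` A) /\ ~ (M `|` A) e].
have [F FQ Fchain|A [[Al Ae] Amax]] := @Zorn_bigcup R Q.
  have [[X0 FX0]|F0] := pselect (F !=set0); last first.
    have -> : \bigcup_(X in F) X = set0.
      by apply/seteqP; split => // x [X FX]; case: F0; exists X.
    rewrite /Q /mkset setU0; split => // Me'; apply: MT; exact: eT.
  have MF x : (M `|` \bigcup_(X in F) X) x -> exists2 X, F X & (M `|` X) x.
    by case=> [Mx|[X FX Xx]]; [exists X0 => //; left | exists X => //; right].
  have FM X x : F X -> (M `|` X) x -> (M `|` \bigcup_(X in F) X) x.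
    by move=> FX [Mx|Xx]; [left | right; exists X].
  have Fl X : F X -> left_ideal (M `|` X) by move=> /FQ [].
  rewrite /Q /=; split; last by move=> /MF [X /FQ [_ Xe]].
  split; first split.
  - by apply: (FM X0) => //; exact: (ideal0 (Fl _ FX0)).
  - move=> x y /MF [X FX Xx] /MF [Y FY Yy].
    have [XY|YX] := Fchain X Y FX FY.
      by apply: (FM Y) => //; apply: idealB => //; [exact: Fl | exact: setUS Xx].
    by apply: (FM X) => //; apply: idealB => //; [exact: Fl | exact: setUS Yy].
  - by move=> r x /MF [X FX Xx]; apply: (FM X) => //; apply: idealM => //; exact: Fl.
exists (M `|` A); split; [|by move=> x; left|exact: Ae].
split=> //; first by move=> AT; apply: Ae; rewrite AT.
move=> L Ll AL; have [LA|LA] := pselect (L `<=` M `|` A).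
  by left; apply/seteqP.
right; apply: eT => //; first by move=> x Mx; apply: AL; left.
have ML : M `<=` L by move=> x Mx; apply: AL; left.
apply: contrapT => Le; apply: (Amax L); last first.
  rewrite /Q /mkset.
  have -> : M `|` L = L by apply/seteqP; split=> x; [case=> [/ML|] | right].
  by [].
split; first by move=> x Ax; apply: AL; right.
by move=> LA'; apply: LA => x /LA' Ax; right.
Qed.

Definition fin_cap (I : eqType) (A : I -> set R) (s : seq I) : set R :=
  [set x | forall i, i \in s -> A i x].

Section FiniteIntersections.
Variable I : eqType.
Implicit Types (A : I -> set R) (s : seq I).

Lemma fin_cap_nil A : fin_cap A [::] = setT.
Proof. by apply/seteqP; split. Qed.

Lemma fin_cap_cons A i s : fin_cap A (i :: s) = A i `&` fin_cap A s.
Proof.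
apply/seteqP; split=> [x xA|x [Aix xA] j].
  by split=> [|j js]; apply: xA; rewrite inE ?eqxx ?js ?orbT.
by rewrite inE => /orP[/eqP->|/xA].
Qed.

Lemma left_ideal_fin_cap A s : (forall i, i \in s -> left_ideal (A i)) ->
  left_ideal (fin_cap A s).
Proof.
elim: s => [|i s IH] sA; first by rewrite fin_cap_nil.
rewrite fin_cap_cons; apply: left_idealI; first by apply: sA; rewrite inE eqxx.
by apply: IH => j js; apply: sA; rewrite inE js orbT.
Qed.

(** When the A i are maximal left ideals, coindependence of the list says that
    R maps onto the product of the simple modules R / A i. *)
Fixpoint coindependent A s : Prop :=
  if s is i :: s' then ~ (fin_cap A s' `<=` A i) /\ coindependent A s' else True.

Lemma coindependent_uniq A s : coindependent A s -> uniq s.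
Proof.
elim: s => //= i s IH [iA /IH ->]; rewrite andbT.
by apply/negP => si; apply: iA => x; apply.
Qed.

(** By maximality the intersection of the later ideals is comaximal with A i, so
    a solution for the tail can be corrected by an element of that
    intersection. *)
Lemma chinese_remainder A s (y : I -> R) :
  (forall i, i \in s -> maximal_left_ideal (A i)) -> coindependent A s ->
  exists x, forall i, i \in s -> A i (x - y i).
Proof.
elim: s => [|i s IH] sA; first by exists 0.
case=> iA cs; have sA' j : j \in s -> maximal_left_ideal (A j).
  by move=> js; apply: sA; rewrite inE js orbT.
have [x xP] := IH sA' cs.
have sl : left_ideal (fin_cap A s) by apply: left_ideal_fin_cap => j /sA' [].
have Aimax : maximal_left_ideal (A i) by apply: sA; rewrite inE eqxx.
have [m ms Am] := maximal_add (y i - x) Aimax sl iA.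
have [Ail _ _] := Aimax.
exists (x + m) => j; rewrite inE => /orP[/eqP->|js].
  by rewrite -[_ - _]opprK; apply: (idealN Ail); rewrite opprB opprD addrA.
have [Ajl _ _] := sA' j js.
by rewrite addrAC; apply: (idealD Ajl); [exact: xP | exact: ms].
Qed.

(** Modular units of the A i are glued as in the Chinese remainder theorem. *)
Lemma modular_fin_cap A s :
  (forall i, i \in s -> maximal_left_ideal (A i) /\ modular (A i)) ->
  modular (fin_cap A s).
Proof.
elim: s => [|i s IH] sA; first by exists 0 => x i.
have sA' j : j \in s -> maximal_left_ideal (A j) /\ modular (A j).
  by move=> js; apply: sA; rewrite inE js orbT.
have [e eP] := IH sA'.
have sl : left_ideal (fin_cap A s) by apply: left_ideal_fin_cap => j /sA' [[]].
have [Aimax [f fP]] : maximal_left_ideal (A i) /\ modular (A i).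
  by apply: sA; rewrite inE eqxx.
have [Ail _ _] := Aimax.
have [iA|iA] := pselect (fin_cap A s `<=` A i).
  by exists e => x; rewrite fin_cap_cons; split=> //; exact: iA.
have [q qs Aq] := maximal_add (f - e) Aimax sl iA.
exists (e + q) => x; rewrite fin_cap_cons rmulDr opprD addrA; split.
  have -> : x - x ** e - x ** q = x - x ** f + x ** (f - e - q).
    by rewrite !rmulBr !addrA subrK.
  by apply: (idealD Ail) => //; exact: idealM.
by apply: (idealB sl) => //; exact: (idealM sl).
Qed.

(** The quotient of R by the intersection is semisimple, so the image of M has a
    complement C.  It is reached by cutting C down by each A i in turn, unless
    C `&` M already lies in A i; in the other case C `&` M is comaximal with
    A i, and the cut does not destroy R = C + M. *)
Lemma fin_cap_complement A s M :
  (forall i, i \in s -> maximal_left_ideal (A i)) -> left_ideal M ->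
  exists C, [/\ left_ideal C, forall x, exists2 c, C c & M (x - c) &
                C `&` M `<=` fin_cap A s].
Proof.
move=> sA Ml; elim: s sA => [|i s IH] sA.
  exists setT; split=> // x.
  by exists x => //; rewrite subrr; exact: ideal0.
have [C [Cl CM Cs]] := IH (fun j js => sA j (mem_behead (s := i :: s) js)).
have Aimax : maximal_left_ideal (A i) by apply: sA; rewrite inE eqxx.
have [Ail _ _] := Aimax.
have [CA|CA] := pselect (C `&` M `<=` A i).
  by exists C; split=> // x Cx; rewrite fin_cap_cons; split; [exact: CA | exact: Cs].
exists (C `&` A i); split; first exact: left_idealI.
  move=> x; have [c Cc Mxc] := CM x.
  have [r [Cr Mr] Acr] := maximal_add c Aimax (left_idealI Cl Ml) CA.
  exists (c - r); first by split=> //; exact: idealB.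
  by rewrite opprB addrCA; apply: idealD.
by move=> x [[Cx Ax] Mx]; rewrite fin_cap_cons; split=> //; exact: Cs.
Qed.

(** In the semisimple quotient every submodule is an intersection of maximal
    ones.  If C is a complement of M and the C-component c of x is outside A i,
    then P = (C `&` A i) + M is maximal because R / P is isomorphic to
    C / (C `&` A i), hence to the simple module R / A i. *)
Lemma maximal_above_fin_cap A s M x :
  (forall i, i \in s -> maximal_left_ideal (A i)) -> left_ideal M ->
  fin_cap A s `<=` M -> ~ M x ->
  exists P, [/\ maximal_left_ideal P, M `<=` P & ~ P x].
Proof.
move=> sA Ml sM Mx; have [C [Cl CM Cs]] := fin_cap_complement sA Ml.
have [c Cc Mxc] := CM x.
have Mc : ~ M c by move=> Mc; apply: Mx; exact: (idealBr Ml Mxc).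
have [i si Aic] : exists2 i, i \in s & ~ A i c.
  apply: contrapT => H; apply: Mc; apply: sM => i si.
  by apply: contrapT => Aic; apply: H; exists i.
have [Ail _ _] := sA i si.
have CAl := left_idealI Cl Ail.
pose P := ideal_add (C `&` A i) M.
have Pl : left_ideal P by exact: left_ideal_add.
have MP : M `<=` P by exact: ideal_addr.
have Px : ~ P x.
  move=> Px; have [c' [Cc' Ac'] Mcc'] : P c.
    by apply: (idealBl Pl (MP _ Mxc)).
  have /Cs /(_ i si) : (C `&` M) (c - c') by split=> //; exact: idealB.
  by move=> /(idealBr Ail) /(_ Ac').
exists P; split=> //; split=> //; first by move=> PT; apply: Px; rewrite PT.
move=> L Ll PL; have [LP|LP] := pselect (L `<=` P); first by left; apply/seteqP.
right; apply/seteqP; split=> // t _.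
have [m Lm Pm] : exists2 m, L m & ~ P m.
  by apply: contrapT => H; apply: LP => m Lm; apply: contrapT => Pm; apply: H; exists m.
have [d Cd Mmd] := CM m.
have Ld : L d by apply: (idealBl Ll (PL _ (MP _ Mmd))).
have Ad : ~ A i d by move=> Ad; apply: Pm; exists d.
have [c2 Cc2 Mtc2] := CM t; apply: (idealBr Ll (PL _ (MP _ Mtc2))).
have [q [Cq Lq] Aq] : exists2 q, (C `&` L) q & A i (c2 - q).
  by apply: maximal_add; [exact: sA | exact: left_idealI | move=> /(_ d (conj Cd Ld))].
apply: (idealBr Ll _ Lq); apply: PL; apply: (ideal_addl Ml).
by split=> //; exact: idealB.
Qed.

End FiniteIntersections.

End RngTheory.

(** * Linearly compact rings and their open maximal left ideals *)

Section MinimalIdempotents.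
Variable R : rngType.
Implicit Types (x y z r e w : R) (L M C P : set R).

(** Re is a minimal left ideal: it is generated by each of its nonzero
    elements, and w ** e = w says that w lies in Re. *)
Definition minimal_idempotent e := [/\ e ** e = e, e <> 0 &
  forall w, w ** e = w -> w <> 0 -> exists r, r ** w = e].

(** R / left_ann w is isomorphic to the simple module Rw = Re. *)
Lemma left_ann_maximal e w : minimal_idempotent e -> w ** e = w -> w <> 0 ->
  maximal_left_ideal (left_ann w).
Proof.
move=> [ee e0 emin] we w0; split; first exact: left_ideal_ann.
- have [r rw] := emin w we w0; move=> wT; apply: e0; rewrite -rw.
  by have : [set: R] r by []; rewrite -wT.
- move=> M Ml wM; have [Mw|Mw] := pselect (M `<=` left_ann w).
    by left; apply/seteqP.
  have [m Mm mw] : exists2 m, M m & m ** w <> 0.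
    apply: contrapT => H; apply: Mw => m Mm; apply: contrapT => mw.
    by apply: H; exists m.
  right; apply/seteqP; split=> // x _.
  have [|r rmw] := emin (m ** w) _ mw; first by rewrite -rmulA we.
  apply: (idealBr Ml (y := x ** w ** r ** m)); last exact: idealM.
  by apply: wM; rewrite /left_ann /= rmulBl -!rmulA rmw we subrr.
Qed.

End MinimalIdempotents.

Lemma nbhs_fin_cap (R : rngType) (N : set_system R) (I : eqType) (A : I -> set R) (s : seq I) :
  Filter N -> (forall i, i \in s -> N (A i)) -> N (fin_cap A s).
Proof.
move=> FN; elim: s => [|i s IH] sA; first by rewrite fin_cap_nil; exact: filterT.
rewrite fin_cap_cons; apply: filterI; first by apply: sA; rewrite inE eqxx.
by apply: IH => j js; apply: sA; rewrite inE js orbT.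
Qed.

(** Compactness is only asked for cosets of open left ideals, which are closed;
    families of cosets are indexed, so that the finite intersection property
    becomes the solvability of finitely many congruences y = x i mod L i. *)
Record linearly_compact_filter (R : rngType) (N : set_system R) : Prop :=
  LinearlyCompactFilter {
  lcf_ring : ring_filter (@rmul R) N;
  lcf_linear : forall V, N V -> exists L, [/\ left_ideal L, N L & L `<=` V];
  lcf_compact : forall (I : choiceType) (D : set I) (x : I -> R) (L : I -> set R),
    (forall i, D i -> left_ideal (L i) /\ N (L i)) ->
    (forall s : seq I, (forall i, i \in s -> D i) ->
       exists y, forall i, i \in s -> L i (y - x i)) ->
    exists y, forall i, D i -> L i (y - x i)
}.

Section LinearlyCompact.
Variables (R : rngType) (N : set_system R).
Hypothesis N_lc : linearly_compact_filter N.
Implicit Types (x y z r e w : R) (L M C P S : set R).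

Let N_ring := lcf_ring N_lc.
#[local] Instance lc_filter : Filter N := rf_filter N_ring.

(** A linear Hausdorff topology is separated by its open left ideals. *)
Lemma zero_of_open_ideals x :
  (forall L, left_ideal L -> N L -> L x) -> x = 0.
Proof.
move=> Lx; apply: (rf_sep N_ring) => V /(lcf_linear N_lc) [L [Ll NL]].
by apply; exact: Lx.
Qed.

Definition open_maximal P := [/\ maximal_left_ideal P, modular P & N P].

(** The image of a linearly compact module under a continuous homomorphism is
    closed; here the homomorphism is y |-> y - y ** i. *)
Lemma range_modular_closed i c :
  (forall L, left_ideal L -> N L -> exists y, L (y - y ** i - c)) ->
  exists y, c = y - y ** i.
Proof.
move=> Lc; pose D := [set L | left_ideal L /\ N L].
pose phi z := z - z ** i.
have phiB a b : phi (a - b) = phi a - phi b.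
  by rewrite /phi rmulBl !opprD !opprK addrACA.
have phiM a b : phi (a ** b) = a ** phi b by rewrite /phi -rmulA -rmulBr.
have [y yP] : {y : set R -> R & forall L, D L -> L (phi (y L) - c)}.
  apply: (@choice _ _ (fun L z => D L -> L (phi z - c))) => L.
  have [[Ll NL]|DL] := pselect (D L); last by exists 0 => /DL.
  by have [z Lz] := Lc L Ll NL; exists z.
have [||z zA] := @lcf_compact _ _ N_lc (set R) D y (fun L => phi @^-1` L).
- move=> L [Ll NL]; split.
    split; first split; rewrite /preimage /=.
    + by rewrite /phi rmul0x subrr; exact: ideal0.
    + by move=> a b La Lb; rewrite phiB; exact: idealB.
    + by move=> r a La; rewrite phiM; exact: idealM.
  apply: filterS (filterI NL (rf_mulr N_ring i NL)) => a [La /= Lai].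
  exact: idealB.
- move=> s sD; have [||z zs] := Lc (fin_cap id s).
  + by apply: left_ideal_fin_cap => L /sD [].
  + by apply: nbhs_fin_cap => L /sD [].
  exists z => L Ls; have [Ll NL] := sD L Ls.
  rewrite /preimage /= phiB; apply: (idealBr Ll _ (idealN Ll (yP L (sD L Ls)))).
  by rewrite opprK addrA subrK; exact: (zs L Ls).
exists z; apply/eqP; rewrite eq_sym -subr_eq0; apply/eqP.
apply: zero_of_open_ideals => L Ll NL.
apply: (idealBr Ll _ (yP L (conj Ll NL))).
by rewrite opprB addrA subrK -phiB; exact: (zA L (conj Ll NL)).
Qed.

Section NoInfiniteChain.
Variables (L : set R) (A : nat -> set R) (t : nat -> R).
Hypotheses (L_ideal : left_ideal L) (NL : N L).
Hypotheses (A_max : forall k, maximal_left_ideal (A k)) (LA : forall k, L `<=` A k).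
Hypotheses (tA : forall i k, (i < k)%N -> A i (t k)) (tA' : forall k, ~ A k (t k)).

Let Al k : left_ideal (A k). Proof. by have [] := A_max k. Qed.
Let NA k : N (A k). Proof. by apply: filterS NL; exact: LA. Qed.

Let bound (s : seq nat) : exists n, forall i, i \in s -> (i < n)%N.
Proof.
by exists (\max_(i <- s) i).+1 => i si; rewrite ltnS; exact: leq_bigmax_seq.
Qed.

(** R maps onto the whole infinite product of the R / A k. *)
Lemma chain_remainder (y : nat -> R) : exists x, forall k, A k (x - y k).
Proof.
have coind n : coindependent A (rev (iota 0 n)).
  elim: n => // n IH; rewrite -addn1 iotaD rev_cat; split=> //= AnP.
  apply: (tA' (k := n)); apply: AnP => k; rewrite mem_rev mem_iota => /andP[_].
  exact: tA.
have fin n : exists x, forall k, (k < n)%N -> A k (x - y k).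
  have [x xP] := chinese_remainder y (fun k _ => A_max k) (coind n).
  by exists x => k kn; apply: xP; rewrite mem_rev mem_iota.
have [||x xP] := @lcf_compact _ _ N_lc nat setT y A; first by [].
- move=> s _; have [n sn] := bound s; have [x xP] := fin n.
  by exists x => i /sn; exact: xP.
- by exists x => k; exact: xP.
Qed.

(** The elements of R vanishing in almost all the quotients R / A k form a direct
    sum inside the product, which is not linearly compact: the cosets of
    y k + A k inside S have the finite intersection property, but a common
    point would have all its coordinates nonzero. *)
Lemma no_infinite_chain : False.
Proof.
pose S := [set x | exists n, forall k, (n <= k)%N -> A k x].
have Sl : left_ideal S.
  split; first split; first by exists 0%N => k _; exact: ideal0.
    move=> a b [m am] [n bn]; exists (maxn m n) => k; rewrite geq_max => /andP[mk nk].
    by apply: idealB => //; [exact: am | exact: bn].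
  by move=> r a [m am]; exists m => k mk; apply: idealM => //; exact: am.
have LS : L `<=` S by move=> x Lx; exists 0%N => k _; exact: LA.
have [y yP] : {y : nat -> R & forall k, A k (y k - t k) /\ forall i, i != k -> A i (y k)}.
  apply: (@choice _ _ (fun k x => A k (x - t k) /\ forall i, i != k -> A i x)) => k.
  have [x xP] := chain_remainder (fun i => if i == k then t k else 0).
  exists x; split; first by have := xP k; rewrite eqxx.
  by move=> i /negPf ik; have := xP i; rewrite ik subr0.
have yS k : S (y k).
  by exists k.+1 => i ki; apply: (yP k).2; rewrite gtn_eqF.
have [||x xP] := @lcf_compact _ _ N_lc nat setT y (fun k => S `&` A k).
- move=> k _; split; first exact: left_idealI.
  by apply: filterS NL => l Ll; split; [exact: LS | exact: LA].
- move=> s _; have [n sn] := bound s.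
  exists (\sum_(i < n) y i) => k /sn kn; split.
    by apply: idealB => //; apply: ideal_sum.
  rewrite (bigD1 (Ordinal kn)) //= addrAC subrr add0r.
  apply: ideal_sum => // i ik; apply: (yP i).2.
  by apply: contra ik => /eqP ki; apply/eqP/val_inj; rewrite /= ki.
have [n xn] : S x.
  by have [xS _] := xP 0%N I; exact: (idealBr Sl xS).
have [_ xA] := xP n I.
by apply: (tA' (k := n)); apply: (idealBl (Al n) (yP n).1);
  apply: (idealBl (Al n) xA); exact: xn.
Qed.
End NoInfiniteChain.

(** A greedy choice of ideals, each one not containing the intersection of the
    previous ones, has to stop by [no_infinite_chain]. *)
Lemma finite_coindependent (X : eqType) (Q : set X) (A : X -> set R) L :
  left_ideal L -> N L ->
  (forall i, Q i -> maximal_left_ideal (A i) /\ L `<=` A i) ->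
  exists s : seq X, [/\ forall i, i \in s -> Q i, coindependent A s &
    forall i, Q i -> fin_cap A s `<=` A i].
Proof.
move=> Ll NL QA; apply: contrapT => H.
pose good s := (forall i, i \in s -> Q i) /\ coindependent A s.
have [f fP] : {f : seq X -> option X & forall s, good s -> exists i,
    [/\ f s = Some i, Q i & ~ (fin_cap A s `<=` A i)]}.
  apply: (@choice _ _ (fun s o => good s -> exists i,
    [/\ o = Some i, Q i & ~ (fin_cap A s `<=` A i)])) => s.
  have [[sQ sc]|gs] := pselect (good s); last by exists None => /gs.
  apply: contrapT => H'; apply: H; exists s; split=> // i Qi r rs.
  apply: contrapT => Axr; apply: H'; exists (Some i) => _; exists i; split=> //.
  by move=> /(_ r rs).
pose fix F n := if n is m.+1 then
  (if f (F m) is Some i then i :: F m else [::]) else [::] : seq X.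
have Fgood n : good (F n).
  elim: n => [//|n IH]; have [i [fi Qi iA]] := fP _ IH.
  rewrite /= fi; split; last by split=> //; case: IH.
  by move=> j; rewrite inE => /orP[/eqP->//|]; case: IH => + _; apply.
have [x xP] : {x : nat -> X & forall n,
    [/\ f (F n) = Some (x n), Q (x n) & ~ (fin_cap A (F n) `<=` A (x n))]}.
  by apply: (@choice _ _ (fun n i => [/\ f (F n) = Some i, Q i &
    ~ (fin_cap A (F n) `<=` A i)])) => n; exact: fP.
have [t tP] : {t : nat -> R & forall n, fin_cap A (F n) (t n) /\ ~ A (x n) (t n)}.
  apply: (@choice _ _ (fun n r => fin_cap A (F n) r /\ ~ A (x n) r)) => n.
  have [_ _ nA] := xP n; apply: contrapT => H'; apply: nA => r rF.
  by apply: contrapT => Ar; apply: H'; exists r.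
have xF i k : (i < k)%N -> x i \in F k.
  elim: k => // k IH; rewrite ltnS leq_eqVlt => /orP[/eqP->|/IH xi].
    by rewrite /=; have [-> _ _] := xP k; rewrite inE eqxx.
  by rewrite /=; have [-> _ _] := xP k; rewrite inE xi orbT.
apply: (@no_infinite_chain L (A \o x) t) => //= k.
- by have [_ /QA [] ] := xP k.
- by have [_ /QA [] ] := xP k.
- by move=> j kj; apply: (tP j).1; exact: xF.
- exact: (tP k).2.
Qed.

(** In a linear topology these are the closed left ideals. *)
Definition ideal_closed S := left_ideal S /\
  forall x, (forall L, left_ideal L -> N L -> S `<=` L -> L x) -> S x.

(** Zorn's lemma on the closed left ideals S that meet the coset e + P.  The
    intersection of a chain still meets that coset by linear compactness. *)
Lemma minimal_supplement P e : left_ideal P -> N P -> exists S,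
  [/\ ideal_closed S, exists2 t, S t & P (t - e) &
      forall S', ideal_closed S' -> (exists2 t, S' t & P (t - e)) ->
        S' `<=` S -> S `<=` S'].
Proof.
move=> Pl NP; pose meets S := exists2 t, S t & P (t - e).
(* Unions of complements are complements of intersections. *)
pose Q : set (set R) := [set A | ideal_closed (~` A) /\ meets (~` A)].
have mT : meets [set: R] by exists e => //; rewrite subrr; exact: ideal0.
have [F FQ Fchain|A [[Acl Am] Amax]] := @Zorn_bigcup R Q; last first.
  exists (~` A); split=> // S' S'cl S'm S'A x Ax; apply: contrapT => S'x.
  apply: (Amax (~` S')); last by rewrite /Q /= setCK.
  split; first by rewrite -[A]setCK; exact: subsetC.
  by move=> /(_ x S'x).
rewrite /Q /= setC_bigcup; split.
  split; first split; first split.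
  - by move=> X /FQ [[Xl _] _]; exact: ideal0.
  - by move=> x y xX yX X FX; have [[Xl _] _] := FQ X FX;
      apply: (idealB Xl); [exact: xX | exact: yX].
  - by move=> r x xX X FX; have [[Xl _] _] := FQ X FX; apply: (idealM Xl); exact: xX.
  - move=> x xL X FX; have [[_ Xc] _] := FQ X FX; apply: Xc => L Ll NL XL.
    by apply: xL => // y yX; apply: XL; exact: yX.
(* R itself is added to the chain so that a finite set of indices always has
   a member of the chain below it, even when the chain is empty. *)
pose G : set (set R) := [set S | S = setT \/ F (~` S)].
have Gcl S : G S -> meets S.
  by case=> [->//|/FQ []]; rewrite setCK.
have Gchain S S' : G S -> G S' -> S `<=` S' \/ S' `<=` S.
  case=> [-> _|FS]; first by right.
  case=> [->|FS']; first by left.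
  by have [/subsetC|/subsetC] := Fchain _ _ FS FS'; rewrite !setCK; [right | left].
pose D (o : option (set R)) := if o is Some M then
  [/\ left_ideal M, N M & exists2 S, G S & S `<=` M] else True.
have [||y yP] := @lcf_compact _ _ N_lc (option (set R)) D
  (fun o => if o is None then e else 0) (fun o => if o is Some M then M else P).
- by case=> [M []|_].
- move=> s sD.
  have [S GS Ss] : exists2 S, G S & forall M, Some M \in s -> S `<=` M.
    elim: s sD => [|o s IH] sD; first by exists setT => //; left.
    have [|S GS Ss] := IH; first by move=> i si; apply: sD; rewrite inE si orbT.
    have := sD o; rewrite inE eqxx => /(_ isT).
    case: o sD => [M|] sD /=; last by move=> _; exists S => // M; rewrite inE => /Ss.
    move=> [_ _ [S' GS' S'M]].
    have [SS'|S'S] := Gchain _ _ GS GS'.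
      by exists S => // M'; rewrite inE => /orP[/eqP[->]|/Ss//];
        exact: subset_trans S'M.
    exists S' => // M'; rewrite inE => /orP[/eqP[->]//|/Ss].
    exact: subset_trans.
  have [t St Pt] := Gcl S GS; exists t => -[M|] si //.
  by rewrite subr0; exact: (Ss M).
exists y; last exact: (yP None I).
move=> X FX /=; have [[Xl Xc] _] := FQ X FX; apply: Xc => L Ll NL XL.
have := yP (Some L); rewrite subr0; apply; split=> //.
by exists (~` X) => //; right; rewrite setCK.
Qed.

Hypothesis R_ss : semisimple R.

(** It suffices that x lies in every maximal modular left ideal.  An element i
    of the intersection I0 of the open ones is quasi-regular: otherwise the set
    of all y - y ** i, which is closed, would lie with some open left ideal in
    a proper left ideal, and any maximal left ideal above it would be open and
    modular with unit i, yet contain i.  A quasi-regular left ideal lies in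
    every maximal modular left ideal. *)
Lemma open_maximal_sep x : (forall P, open_maximal P -> P x) -> x = 0.
Proof.
move=> xP; suff : jacobson_radical (R := R) x by rewrite R_ss.
pose I0 := [set y | forall P, open_maximal P -> P y].
have I0l : left_ideal I0.
  split; first split.
  - by move=> P [[Pl _ _] _ _]; exact: ideal0.
  - by move=> a b aI bI P Pm; have [[Pl _ _] _ _] := Pm;
      apply: (idealB Pl); [exact: aI | exact: bI].
  - by move=> r a aI P Pm; have [[Pl _ _] _ _] := Pm; apply: (idealM Pl); exact: aI.
have qreg i c : I0 i -> exists y, c = y - y ** i.
  move=> I0i; apply: contrapT => Sc.
  have [L [Ll NL Lc]] : exists L, [/\ left_ideal L, N L &
      forall y, ~ L (y - y ** i - c)].
    apply: contrapT => H; apply: Sc; apply: range_modular_closed => L Ll NL.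
    apply: contrapT => H'; apply: H; exists L; split=> // y Ly.
    by apply: H'; exists y.
  pose S := [set z | exists y, z = y - y ** i].
  have Sl : left_ideal S.
    split; first split.
    - by exists 0; rewrite rmul0x subrr.
    - move=> _ _ [a ->] [b ->]; exists (a - b).
      by rewrite rmulBl !opprD !opprK addrACA.
    - by move=> r _ [a ->]; exists (r ** a); rewrite rmulBr rmulA.
  have Mi y : ideal_add L S (y - y ** i) by apply: ideal_addr => //; exists y.
  have Ml : left_ideal (ideal_add L S) by exact: left_ideal_add.
  have [|P [Pmax MP Pi]] := modular_maximal Ml Mi.
    move=> MT; have [l Ll' [y cly]] : ideal_add L S c by rewrite MT.
    apply: (Lc y); rewrite -cly addrAC subrr add0r; exact: idealN.
  apply: Pi; apply: I0i; split=> //.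
    by exists i => y; exact: MP.
  by apply: filterS NL => l Ll'; apply: MP; exact: ideal_addl.
move=> M [Mmax [e eM]]; have [Ml MT _] := Mmax.
apply: contrapT => Mx; apply: MT; apply/seteqP; split=> // z _.
have [|i I0i Mei] := maximal_add e Mmax I0l.
  by move=> /(_ x xP).
have [y ->] := qreg i z I0i.
have -> : y - y ** i = y - y ** e + y ** (e - i) by rewrite rmulBr addrA subrK.
by apply: (idealD Ml) => //; exact: idealM.
Qed.

(** Linear compactness allows the intersection over all finite families to be
    moved inside the sum L + fin_cap, and the total intersection is zero. *)
Lemma add_cap_sep L x : left_ideal L -> N L ->
  (forall s : seq (set R), (forall P, P \in s -> open_maximal P) ->
    ideal_add L (fin_cap id s) x) -> L x.
Proof.
move=> Ll NL H.
pose D (o : option (set R)) := if o is Some P then open_maximal P else True.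
have [||y yP] := @lcf_compact _ _ N_lc (option (set R)) D
  (fun o => if o is None then x else 0) (fun o => if o is Some P then P else L).
- by case=> [P [[]]|_].
- move=> s sD; have [|l Ll' xl] := H (pmap id s).
    by move=> P; rewrite mem_pmap map_id => /sD.
  exists (x - l) => -[P|] si.
    by rewrite subr0; apply: xl; rewrite mem_pmap map_id.
  by rewrite addrAC subrr add0r; exact: idealN.
have y0 : y = 0.
  by apply: open_maximal_sep => P Pm; have := yP (Some P) Pm; rewrite subr0.
by have := yP None I; rewrite y0 sub0r => /(idealN Ll); rewrite opprK.
Qed.

(** L is the intersection of the open maximal modular left ideals above it,
    since each L + fin_cap id F is; finitely many of them give the same
    intersection by [finite_coindependent]. *)
Lemma open_ideal_contains_cap L : left_ideal L -> N L ->
  exists s : seq (set R), (forall P, P \in s -> open_maximal P) /\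
    fin_cap id s `<=` L.
Proof.
move=> Ll NL.
have [|s [sQ _ sP]] := @finite_coindependent (set R)
    [set P | open_maximal P /\ L `<=` P] id L Ll NL.
  by move=> P [[]].
exists s; split=> [P /sQ []//|x xs]; apply: add_cap_sep => // F Fm.
have Fmax P : P \in F -> maximal_left_ideal P by move=> /Fm [].
have Fl : left_ideal (fin_cap id F) by apply: left_ideal_fin_cap => P /Fmax [].
apply: contrapT => xLF.
have [|P [Pmax LFP Px]] := maximal_above_fin_cap Fmax (left_ideal_add Ll Fl) _ xLF.
  exact: ideal_addr.
apply: Px; apply: (sP P) => //; split; last first.
  by apply: subset_trans LFP; exact: ideal_addl.
split=> //; last by apply: filterS NL => l Ll'; apply: LFP; exact: ideal_addl.
have [|e eP] := @modular_fin_cap R _ id F; first by move=> Q /Fm [].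
by exists e => z; apply: LFP; exact: ideal_addr.
Qed.

(** A minimal closed S with S + P = R is a complement of P: if S `&` P were not
    contained in some open maximal Q, then S `&` Q would be a smaller
    supplement.  The component in S of a modular unit of P is the idempotent. *)
Lemma open_maximal_minimal_idempotent P : open_maximal P ->
  exists2 e, minimal_idempotent e & P = left_ann e.
Proof.
move=> [Pmax [e0 e0P] NP]; have [Pl PT _] := Pmax.
have [S [Scl [t St Pt] Smin]] := minimal_supplement e0 Pl NP.
have [Sl Sc] := Scl.
have SP0 x : S x -> P x -> x = 0.
  move=> Sx Px; apply: open_maximal_sep => Q Qm.
  have [Qmax _ NQ] := Qm; have [Ql _ _] := Qmax.
  apply: contrapT => Qx.
  have [|z [Sz Pz] Qtz] := maximal_add t Qmax (left_idealI Sl Pl).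
    by move=> /(_ x (conj Sx Px)).
  have [] // : (S `&` Q) x; apply: Smin => //.
  - split; first exact: left_idealI.
    move=> y yL; split; first by apply: Sc => L Ll NL SL; apply: yL => // s [/SL].
    by apply: yL => // s [].
  - exists (t - z); first by split=> //; exact: idealB.
    by rewrite addrAC; exact: idealB.
have tP r : P (r - r ** t).
  have -> : r - r ** t = (r - r ** e0) - r ** (t - e0).
    by rewrite rmulBr opprB addrA subrK.
  by apply: (idealB Pl) => //; exact: idealM.
have St' x : S x -> x ** t = x.
  move=> Sx; apply/esym/eqP; rewrite -subr_eq0; apply/eqP; apply: SP0 (tP x).
  by apply: (idealB Sl) => //; exact: idealM.
have PE : P = left_ann t.
  apply/seteqP; split=> r; rewrite /left_ann /=.
    move=> Pr; apply: SP0; first exact: idealM.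
    exact: (idealBl Pl (tP r)).
  by move=> rt; have := tP r; rewrite rt subr0.
exists t => //; split; first exact: St'.
  move=> t0; apply: PT; rewrite PE t0; apply/seteqP; split=> // r _.
  by rewrite /left_ann /= rmulx0.
move=> w wt w0; have Sw : S w by rewrite -wt; exact: idealM.
have Pw : ~ P w by rewrite PE /left_ann /= wt.
pose M := [set y | exists r, y = r ** w].
have Ml : left_ideal M.
  split; first split.
  - by exists 0; rewrite rmul0x.
  - by move=> _ _ [a ->] [b ->]; exists (a - b); rewrite rmulBl.
  - by move=> r _ [a ->]; exists (r ** a); rewrite rmulA.
(* If Rw were inside P, then the elements y with Ry inside P would form a left
   ideal strictly above P, hence all of R, and P would contain every x. *)
have MP : ~ (M `<=` P).
  move=> MP; apply: PT; apply/seteqP; split=> // x _.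
  have [_ _ /(_ [set y | forall r, P (r ** y)])] := Pmax.
  case.
  - split; first split.
    + by move=> r; rewrite rmulx0; exact: ideal0.
    + by move=> a b aP bP r; rewrite rmulBr; apply: idealB.
    + by move=> s a aP r; rewrite rmulA; exact: aP.
  - by move=> y Py r; exact: idealM.
  - move=> H; case: Pw; rewrite -H => r; apply: MP; by exists r.
  - move=> H; have : [set: R] t by []; rewrite -H => /(_ x) Pxt.
    exact: (idealBr Pl (tP x)).
have [_ [r ->] Ptr] := maximal_add t Pmax Ml MP.
exists r; apply/esym/eqP; rewrite -subr_eq0; apply/eqP; apply: SP0 Ptr.
by apply: (idealB Sl) => //; exact: idealM.
Qed.

Lemma semiprime x : (forall r, x ** r ** x = 0) -> x = 0.
Proof.
move=> xrx; apply: open_maximal_sep => P Pm.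
have [e [ee e0 emin] PE] := open_maximal_minimal_idempotent Pm; rewrite PE.
apply: contrapT => /= xe.
have [|r rxe] := emin (x ** e) _ xe; first by rewrite -rmulA ee.
by apply: xe; rewrite /left_ann /= -rxe rmulA rmulA xrx rmul0x.
Qed.

(** The annihilators of the vectors w in Re killed by L are maximal left ideals
    above L, so finitely many of them, coindependent, have the same
    intersection.  The Chinese remainder theorem produces coordinate forms u i.
    A vector v and its expansion are killed by the same elements:
    r - \sum_i r w_i u_i kills every w_j, hence kills v, for all r. *)
Lemma dual_basis e L : minimal_idempotent e -> left_ideal L -> N L ->
  exists n (w u : 'I_n -> R),
    [/\ forall i, w i ** e = w i /\ L `<=` left_ann (w i),
        forall i, e ** u i = u i,
        forall i j, u i ** w j = if i == j then e else 0 &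
        forall v, v ** e = v -> L `<=` left_ann v ->
          v = \sum_i w i ** (u i ** v)].
Proof.
move=> emi Ll NL; have [ee e0 emin] := emi.
pose Q := [set w | [/\ w ** e = w, w <> 0 & L `<=` left_ann w]].
have Qmax w : Q w -> maximal_left_ideal (left_ann w) /\ L `<=` left_ann w.
  by move=> [we w0 Lw]; split=> //; exact: (left_ann_maximal emi).
have [s [sQ sc sann]] := finite_coindependent Ll NL Qmax.
pose w (i : 'I_(size s)) := s`_i.
have ws i : w i \in s by exact: mem_nth.
have wQ i : Q (w i) by exact: sQ.
have winj i j : (w i == w j) = (i == j).
  by rewrite nth_uniq ?(coindependent_uniq sc).
have [u uP] : {u : 'I_(size s) -> R & forall i, e ** u i = u i /\
    forall j, u i ** w j = if i == j then e else 0}.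
  apply: (@choice _ _ (fun i r => e ** r = r /\
    forall j, r ** w j = if i == j then e else 0)) => i.
  have [we w0 _] := wQ i; have [r rw] := emin _ we w0.
  have [||x xP] := @chinese_remainder R R (@left_ann R) s
    (fun v => if v == w i then r else 0) => //.
    by move=> v /sQ /Qmax [].
  exists (e ** x); split=> [|j]; first by rewrite rmulA ee.
  have := xP _ (ws j); rewrite winj [i == j]eq_sym -rmulA /left_ann /= rmulBl.
  move=> /eqP; rewrite subr_eq0 => /eqP ->.
  by case: eqP => [->|_]; rewrite ?rw ?rmul0x ?rmulx0.
exists (size s), w, u; split.
- by move=> i; have [] := wQ i.
- by move=> i; have [] := uP i.
- by move=> i; have [] := uP i.
move=> v ve Lv; have [->|v0] := pselect (v = 0).
  by rewrite big1 // => i _; rewrite !rmulx0.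
apply/eqP; rewrite -subr_eq0; apply/eqP; apply: contrapT => v'0.
have [|r rv'] := emin _ _ v'0.
  rewrite rmulBl ve rmul_suml; congr (_ - _); apply: eq_bigr => i _.
  by rewrite -!rmulA ve.
apply: e0; rewrite -rv' rmulBr rmul_sumr.
have -> : r ** v - \sum_i r ** (w i ** (u i ** v)) =
    (r - \sum_i r ** w i ** u i) ** v.
  by rewrite rmulBl rmul_suml; congr (_ - _); apply: eq_bigr => i _; rewrite !rmulA.
apply: (sann v) => // x /(nthP 0) [k ks <-].
pose j := Ordinal ks; have -> : s`_k = w j by [].
rewrite /left_ann /= rmulBl rmul_suml (bigD1 j) //= big1.
  by rewrite -rmulA (uP j).2 eqxx addr0 -rmulA; have [-> _ _] := wQ j; rewrite subrr.
by move=> i /negPf ij; rewrite -rmulA (uP i).2 ij rmulx0.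
Qed.

End LinearlyCompact.

(** * The division ring eRe *)

Section Corner.
Variables (R : rngType) (e : R).
Hypothesis e_min : minimal_idempotent e.

Definition corner_pred : {pred R} := [pred x | `[< e ** x ** e = x >]].

Lemma corner_zmod_closed : zmod_closed corner_pred.
Proof.
split; first by apply/asboolP; rewrite rmulx0 rmul0x.
by move=> x y /asboolP xe /asboolP ye; apply/asboolP; rewrite rmulBr rmulBl xe ye.
Qed.

HB.instance Definition _ := GRing.isZmodClosed.Build R corner_pred corner_zmod_closed.

(** The proof that e is minimal is a parameter of the type because the ring
    structure depends on it, through 1 != 0. *)
Record corner (emi : minimal_idempotent e) :=
  Corner { corner_val : R; _ : corner_val \in corner_pred }.
Local Notation D := (corner e_min).

HB.instance Definition _ := [isSub for @corner_val e_min].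
HB.instance Definition _ := [Choice of D by <:].
HB.instance Definition _ := [SubChoice_isSubZmodule of D by <:].

Lemma cornerP (a : D) : e ** val a ** e = val a.
Proof. by apply/asboolP; exact: (valP a). Qed.

Lemma idem_e : e ** e = e. Proof. by have [] := e_min. Qed.

Lemma corner_e_val (a : D) : e ** val a = val a.
Proof. by rewrite -cornerP !rmulA idem_e. Qed.

Lemma corner_val_e (a : D) : val a ** e = val a.
Proof. by rewrite -cornerP -!rmulA idem_e. Qed.

Lemma corner_sandwich_subproof x : e ** x ** e \in corner_pred.
Proof. by apply/asboolP; rewrite -!rmulA idem_e !rmulA idem_e. Qed.

Definition corner_sandwich x : D := Corner e_min (corner_sandwich_subproof x).

Lemma corner_valD (a b : D) : val (a + b) = val a + val b.
Proof. exact: raddfD. Qed.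

Lemma corner_val0 : val (0 : D) = 0.
Proof. exact: raddf0. Qed.

Lemma corner_val_sum I (s : seq I) (F : I -> D) :
  val (\sum_(i <- s) F i) = \sum_(i <- s) val (F i).
Proof. exact: (big_morph _ corner_valD corner_val0). Qed.

Definition corner_one := corner_sandwich e.
Definition corner_mul (a b : D) := corner_sandwich (val a ** val b).

Lemma corner_oneE : val corner_one = e.
Proof. by rewrite /= !idem_e. Qed.

Lemma corner_mulE a b : val (corner_mul a b) = val a ** val b.
Proof. by rewrite /= rmulA (corner_e_val a) -rmulA (corner_val_e b). Qed.

Fact corner_mulA : associative corner_mul.
Proof. by move=> a b c; apply: val_inj; rewrite !corner_mulE rmulA. Qed.
Fact corner_mul1 : left_id corner_one corner_mul.
Proof.
by move=> a; apply: val_inj; rewrite corner_mulE corner_oneE corner_e_val.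
Qed.
Fact corner_mulr1 : right_id corner_one corner_mul.
Proof.
by move=> a; apply: val_inj; rewrite corner_mulE corner_oneE corner_val_e.
Qed.
Fact corner_mulDl : left_distributive corner_mul +%R.
Proof.
by move=> a b c; apply: val_inj; rewrite corner_mulE !corner_valD !corner_mulE rmulDl.
Qed.
Fact corner_mulDr : right_distributive corner_mul +%R.
Proof.
by move=> a b c; apply: val_inj; rewrite corner_mulE !corner_valD !corner_mulE rmulDr.
Qed.
Fact corner_one_neq0 : corner_one != 0.
Proof.
by have [_ e0 _] := e_min; apply/eqP => /(congr1 val); rewrite corner_oneE corner_val0.
Qed.

HB.instance Definition _ := GRing.Zmodule_isNzRing.Build D
  corner_mulA corner_mul1 corner_mulr1 corner_mulDl corner_mulDr corner_one_neq0.

Lemma corner_valM (a b : D) : val (a * b) = val a ** val b.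
Proof. exact: corner_mulE. Qed.

Lemma corner_val1 : val (1 : D) = e.
Proof. exact: corner_oneE. Qed.

(** Minimality of Re gives left inverses of nonzero elements, and in a monoid
    where every nonzero element has a nonzero left inverse these are two-sided. *)
Lemma corner_division : division_ring D.
Proof.
have linv (a : D) : a != 0 -> exists b, b * a = 1.
  move=> a0; have [_ _ emin] := e_min.
  have [|r ra] := emin (val a) (corner_val_e a).
    by move/eqP; rewrite -corner_val0 (inj_eq val_inj) (negPf a0).
  exists (corner_sandwich r); apply: val_inj.
  by rewrite corner_valM /= -!rmulA corner_e_val ra !idem_e.
move=> a a0; have [b ba] := linv a a0.
have b0 : b != 0.
  by apply: contraTneq (oner_neq0 D) => b0; rewrite -ba b0 mul0r eqxx.
have [c cb] := linv b b0.
exists b; split=> //.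
by rewrite -{1}[a]mul1r -cb -[c * b * a]mulrA ba mulr1.
Qed.
End Corner.

(** * Coarser ring topologies *)

Section Pullback.
Variables (D R : zmodType) (mulD : D -> D -> D) (mulR : R -> R -> R).
Variables (g : D -> R) (N : set_system R).
Hypotheses (g_inj : injective g) (gB : {morph g : x y / x - y})
           (gM : {morph g : x y / mulD x y >-> mulR x y}).
Hypothesis N_ring : ring_filter mulR N.

#[local] Instance pullback_base_filter : Filter N := rf_filter N_ring.

Definition pullback_filter : set_system D :=
  [set V | exists2 W, N W & g @^-1` W `<=` V].

Lemma pullback_ring_filter : ring_filter mulD pullback_filter.
Proof.
have g0 : g 0 = 0 by rewrite -(subrr 0) gB subrr.
split.
- split.
  + by exists setT => //; exact: filterT.
  + move=> A B [V NV VA] [W NW WB]; exists (V `&` W); first exact: filterI.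
    by move=> x [/VA Ax /WB Bx].
  + by move=> A B AB [V NV VA]; exists V => //; exact: subset_trans AB.
- by move=> A [V NV VA]; apply: VA; rewrite /preimage /= g0; exact: (rf_zero N_ring).
- move=> A [V /(rf_sub N_ring) [W NW WV] VA].
  exists (g @^-1` W); first by exists W.
  by move=> x y Wx Wy; apply: VA; rewrite /preimage /= gB; exact: WV.
- move=> A [V /(rf_mul N_ring) [W NW WV] VA].
  exists (g @^-1` W); first by exists W.
  by move=> x y Wx Wy; apply: VA; rewrite /preimage /= gM; exact: WV.
- move=> a A [V /(rf_mull N_ring (g a)) NV VA]; eexists; first exact: NV.
  by move=> x; rewrite /preimage /= -gM; exact: VA.
- move=> a A [V /(rf_mulr N_ring (g a)) NV VA]; eexists; first exact: NV.
  by move=> x; rewrite /preimage /= -gM; exact: VA.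
- move=> x xV; apply: g_inj; rewrite g0; apply: (rf_sep N_ring) => V NV.
  by have := xV (g @^-1` V); apply; exists V.
Qed.
End Pullback.

Section Component.
Variables (R : rngType) (e : R) (n : nat) (w u : 'I_n -> R).
Hypothesis e_min : minimal_idempotent e.
Local Notation D := (corner e_min).
Hypotheses (we : forall i, w i ** e = w i) (eu : forall i, e ** u i = u i)
  (uw : forall i j, u i ** w j = if i == j then e else 0)
  (span : forall v, v ** e = v -> v = \sum_i w i ** (u i ** v)).
Hypothesis R_semiprime : forall x : R, (forall r, x ** r ** x = 0) -> x = 0.

(** With w and u dual bases of Re, this is the element acting as the identity on
    Re; it turns out to be the central idempotent of the component ReR. *)
Definition component_unit : R := \sum_i w i ** u i.
Local Notation c := component_unit.

Definition component_matrix (A : 'M[D]_n) : R :=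
  \sum_i \sum_j w i ** val (A i j) ** u j.
Local Notation f := component_matrix.

Let ee : e ** e = e. Proof. by have [] := e_min. Qed.

Lemma unit_span v : v ** e = v -> c ** v = v.
Proof.
by move=> /span vE; rewrite [RHS]vE rmul_suml; apply: eq_bigr => i _; rewrite rmulA.
Qed.

Lemma unit_kills x : (forall v, v ** e = v -> x ** v = 0) <-> x ** c = 0.
Proof.
split=> [xv|xc v ve]; last by rewrite -(unit_span ve) rmulA xc rmul0x.
by rewrite rmul_sumr big1 // => i _; rewrite rmulA xv ?rmul0x.
Qed.

(** The annihilator of Re is a two-sided ideal B with B c = 0, so c x generates a
    nilpotent ideal for x in B. *)
Lemma unit_killsC x : x ** c = 0 -> c ** x = 0.
Proof.
move=> xc; apply: R_semiprime => r.
suff -> : c ** x ** r ** (c ** x) = c ** (x ** r ** c) ** x.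
  have -> : x ** r ** c = 0; last by rewrite rmulx0 rmul0x.
  apply/unit_kills => v ve; rewrite -rmulA.
  by have /unit_kills := xc; apply; rewrite -rmulA ve.
by rewrite !rmulA.
Qed.

Lemma unit_idem : c ** c = c.
Proof.
rewrite {2 3}/component_unit rmul_sumr; apply: eq_bigr => i _.
by rewrite rmulA unit_span.
Qed.

(** Both x - x c and x - c x kill Re, so they are killed by c on both sides. *)
Lemma unit_central x : c ** x = x ** c.
Proof.
have xc : (x - x ** c) ** c = 0 by rewrite rmulBl -rmulA unit_idem subrr.
have cx : (x - c ** x) ** c = 0.
  apply/unit_kills => v ve.
  by rewrite rmulBl -rmulA unit_span ?subrr // -rmulA ve.
have /eqP := unit_killsC xc; rewrite rmulBr subr_eq0 => /eqP ->.
by have /eqP := cx; rewrite rmulBl subr_eq0 -rmulA => /eqP <-.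
Qed.

Lemma matrix_row A i : u i ** f A = \sum_j val (A i j) ** u j.
Proof.
rewrite rmul_sumr (bigD1 i) //= [X in _ + X]big1 ?addr0.
  rewrite rmul_sumr; apply: eq_bigr => j _.
  by rewrite !rmulA uw eqxx corner_e_val.
move=> k /negPf ki; rewrite rmul_sumr big1 // => j _.
by rewrite !rmulA uw eq_sym ki !rmul0x.
Qed.

Lemma matrix_entry A i j : u i ** f A ** w j = val (A i j).
Proof.
rewrite matrix_row rmul_suml (bigD1 j) //= -rmulA uw eqxx corner_val_e big1 ?addr0 //.
by move=> k /negPf kj; rewrite -rmulA uw kj rmulx0.
Qed.

Lemma component_matrix_iso : isomorphic_to_matrix_ring [set x | c ** x = x] n D.
Proof.
exists f; split.
- by move=> A B AB; apply/matrixP => i j; apply: val_inj; rewrite -!matrix_entry AB.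
- apply/seteqP; split=> [_ [A _ <-]|x /= cx].
    rewrite /= rmul_sumr; apply: eq_bigr => i _; rewrite rmul_sumr.
    by apply: eq_bigr => j _; rewrite !rmulA unit_span.
  have xE : x = \sum_i \sum_j w i ** (u i ** x ** w j) ** u j.
    have xc : x = c ** x ** c by rewrite cx -unit_central cx.
    rewrite [LHS]xc /component_unit rmul_suml rmul_suml; apply: eq_bigr => i _.
    by rewrite rmul_sumr; apply: eq_bigr => j _; rewrite !rmulA.
  exists (\matrix_(i, j) corner_sandwich e_min (u i ** x ** w j)) => //.
  rewrite [RHS]xE; apply: eq_bigr => i _; apply: eq_bigr => j _.
  have uxw : e ** (u i ** x ** w j) ** e = u i ** x ** w j.
    by rewrite !rmulA eu -rmulA we.
  by rewrite mxE /= uxw.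
- move=> A B; rewrite /f -big_split; apply: eq_bigr => i _ /=.
  rewrite -big_split; apply: eq_bigr => j _ /=.
  by rewrite mxE corner_valD rmulDr rmulDl.
- move=> A B; rewrite [in RHS]/component_matrix rmul_suml.
  apply: eq_bigr => i _; rewrite rmul_suml.
  under [RHS]eq_bigr => j _.
    rewrite -[_ ** _ ** f B]rmulA matrix_row rmul_sumr; over.
  rewrite exchange_big; apply: eq_bigr => j _ /=.
  rewrite mxE -rmulA corner_val_sum rmul_suml rmul_sumr; apply: eq_bigr => k _.
  by rewrite corner_valM !rmulA.
Qed.
Lemma component_summand : direct_summand [set x | c ** x = x].
Proof.
split.
  split; first split; first split => /=.
  - exact: rmulx0.
  - by move=> x y cx cy; rewrite /= rmulBr cx cy.
  - by move=> r x cx; rewrite /= rmulA unit_central -rmulA cx.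
  - by move=> r x cx; rewrite /= rmulA cx.
exists [set x | c ** x = 0]; split.
- split; first split; first split => /=.
  + exact: rmulx0.
  + by move=> x y cx cy; rewrite /= rmulBr cx cy subrr.
  + by move=> r x cx; rewrite /= rmulA unit_central -rmulA cx rmulx0.
  + by move=> r x cx; rewrite /= rmulA cx rmul0x.
- apply/seteqP; split=> [x [/= cx cx0]|_ ->].
    by rewrite -cx cx0.
  by split; exact: rmulx0.
- move=> x; exists (c ** x), (x - c ** x); split=> /=.
  + by rewrite rmulA unit_idem.
  + by rewrite rmulBr rmulA unit_idem subrr.
  + by rewrite addrC subrK.
Qed.

Lemma component_size_gt0 : (0 < n)%N.
Proof.
rewrite lt0n; apply/eqP => n0; have [_ e0 _] := e_min; apply: e0.
rewrite -(unit_span ee) /component_unit big1 ?rmul0x // => i _.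
by have : (i < 0)%N by rewrite -[X in (_ < X)%N]n0.
Qed.

End Component.

Section CoarserTopology.
Variables (R : rngType) (N N' : set_system R).
Hypothesis N_lc : linearly_compact_filter N.
Hypothesis R_ss : semisimple R.
Hypothesis N'_ring : ring_filter (@rmul R) N'.
Hypothesis N'N : N' `<=` N.

#[local] Instance coarser_filter : Filter N' := rf_filter N'_ring.

(** The hypothesis on e says that Re is infinite dimensional over eRe. *)
Lemma ann_nbhs_unbounded e : minimal_idempotent e ->
  (forall L, left_ideal L -> N L -> exists2 v, v ** e = v & ~ (L `<=` left_ann v)) ->
  N' (left_ann e).
Proof.
move=> emi big; have [ee e0 emin] := emi.
have [V NV Ve] : exists2 V, N' V & ~ V e.
  apply: contrapT => H; apply: e0; apply: (rf_sep N'_ring) => V NV.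
  by apply: contrapT => Ve; apply: H; exists V.
have [W NW WV] := rf_mul N'_ring (rf_mulr N'_ring e NV).
have [L [Ll NL LW]] := lcf_linear N_lc (N'N NW).
(* If s in L did not kill r e, then t s r e = e for some t, and t s is in L,
   hence in W, which contradicts that W W e avoids e. *)
have WL : W `<=` [set r | L `<=` left_ann (r ** e)].
  move=> r Wr s Ls; apply: contrapT => /= sre; apply: Ve.
  have [|t tsre] := emin (s ** (r ** e)) _ sre; first by rewrite -!rmulA ee.
  have : V (t ** s ** r ** e) by apply: WV => //; apply: LW; exact: idealM.
  by move=> Vtsre; rewrite -tsre !rmulA.
have [n [w [u [wP eu uw span]]]] := dual_basis N_lc emi Ll NL.
(* The vectors killed by L form a proper subspace of Re with basis w; v lies
   outside it.  If r e is in the subspace and has a nonzero coordinate d, then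
   v u_i r e = v d is outside the subspace, as d is invertible. *)
have [v ve Lv] := big L Ll NL.
have : N' (W `&` [set r | forall i, W (v ** u i ** r)]).
  by apply: filterI => //; apply: filter_forall => i; exact: (rf_mull N'_ring).
apply: filterS => r [Wr ur]; rewrite /left_ann /=.
rewrite (span (r ** e)); first last.
- exact: WL.
- by rewrite -rmulA ee.
rewrite big1 // => i _; suff -> : u i ** (r ** e) = 0 by rewrite rmulx0.
apply: contrapT => ure; apply: Lv => l Ll'.
set d := u i ** (r ** e) in ure.
have de : e ** d ** e = d by rewrite /d rmulA eu -!rmulA ee.
have [|y [dy _]] := corner_division (x := corner_sandwich emi d).
  by apply/eqP => /(congr1 val); rewrite /= de.
have sE : val (corner_sandwich emi d) = d := de.
move/(congr1 val): dy; rewrite corner_valM sE corner_val1 => dy.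
rewrite /left_ann /= -ve -dy; have := WL _ (ur i) l Ll'.
by rewrite /left_ann /d /= !rmulA => ->; rewrite rmul0x.
Qed.

(** R is represented on the finite dimensional space Re by matrices over eRe, and
    left_ann e is the set of those r for which the finitely many coordinates
    u i ** r ** e vanish; in a discrete topology of eRe this is an open
    condition. *)
Lemma ann_nbhs_bounded e L : minimal_idempotent e ->
  ~ (exists (I : set R) (n : nat) (D : nzRingType),
       [/\ direct_summand I, (0 < n)%N, division_ring D,
           isomorphic_to_matrix_ring I n D & admits_nondiscrete_topology D]) ->
  left_ideal L -> N L -> (forall v, v ** e = v -> L `<=` left_ann v) ->
  N' (left_ann e).
Proof.
move=> emi no_summand Ll NL Lv; have [ee e0 emin] := emi.
have [n [w [u [wP eu uw span']]]] := dual_basis N_lc emi Ll NL.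
have we i : w i ** e = w i by have [] := wP i.
have span v : v ** e = v -> v = \sum_i w i ** (u i ** v).
  by move=> ve; apply: span' => //; exact: Lv.
have sp := semiprime N_lc R_ss.
pose D := corner emi : nzRingType.
pose ND := pullback_filter (val : D -> R) N'.
have ND_ring : ring_filter (@GRing.mul D) ND.
  apply: (pullback_ring_filter _ _ _ N'_ring); first exact: val_inj.
    by move=> x y; exact: raddfB.
  by move=> x y; exact: corner_valM.
have [TD [TD_haus TD_ring TDE]] := ring_filter_topology (@mulrDl D) (@mulrDr D) ND_ring.
have : discrete TD.
  apply: contrapT => nd; apply: no_summand.
  exists [set x | component_unit w u ** x = x], n, D; split.
  - exact: (component_summand we span sp).
  - exact: (component_size_gt0 emi span).
  - exact: corner_division.
  - exact: (component_matrix_iso emi we eu uw span sp).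
  - by exists TD.
move=> /(discrete_nbhs0 TD_ring); rewrite TDE => -[W NW W0].
have : N' [set r | forall i, W (u i ** r ** e)].
  apply: filter_forall => i.
  exact: (rf_mull N'_ring (u i) (rf_mulr N'_ring e NW)).
apply: filterS => r ur; rewrite /left_ann /= (span (r ** e)); last first.
  by rewrite -rmulA ee.
rewrite big1 // => i _.
have de : e ** (u i ** r ** e) ** e = u i ** r ** e.
  by rewrite !rmulA eu -!rmulA ee.
have sE : val (corner_sandwich emi (u i ** r ** e)) = u i ** r ** e := de.
have /(congr1 val) : corner_sandwich emi (u i ** r ** e) = 0.
  by apply: W0; rewrite /preimage /mkset sE; exact: ur.
by rewrite sE corner_val0 => ure; rewrite (rmulA (u i)) ure rmulx0.
Qed.

(** It suffices to treat the annihilators of minimal idempotents, since finite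
    intersections of these generate N. *)
Theorem linearly_compact_minimal :
  ~ (exists (I : set R) (n : nat) (D : nzRingType),
       [/\ direct_summand I, (0 < n)%N, division_ring D,
           isomorphic_to_matrix_ring I n D & admits_nondiscrete_topology D]) ->
  N `<=` N'.
Proof.
move=> no_summand V NV; have [L [Ll NL LV]] := lcf_linear N_lc NV.
have [s [sP sL]] := open_ideal_contains_cap N_lc R_ss Ll NL.
apply: (filterS (subset_trans sL LV)).
have {}sP P : P \in s -> N' P.
  move=> /sP /(open_maximal_minimal_idempotent N_lc R_ss) [e emi ->].
  have [[M [Ml NM Mv]]|big] := pselect (exists M, [/\ left_ideal M, N M &
      forall v, v ** e = v -> M `<=` left_ann v]).
    exact: (ann_nbhs_bounded emi no_summand Ml NM).
  apply: ann_nbhs_unbounded => // M Ml NM; apply: contrapT => H; apply: big.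
  exists M; split=> // v ve l Ml'; apply: contrapT => lv; apply: H.
  by exists v => // /(_ l Ml').
exact: nbhs_fin_cap.
Qed.
End CoarserTopology.

(** * Matrix rings as direct summands *)

Lemma ring_filter_sum (R : zmodType) (mul : R -> R -> R) (N : set_system R) n V :
  ring_filter mul N -> N V ->
  exists2 W, N W & forall F : 'I_n -> R, (forall i, W (F i)) -> V (\sum_i F i).
Proof.
move=> N_ring; have FN := rf_filter N_ring; elim: n V => [|n IH] V NV.
  exists V => // F _; rewrite big_ord0; exact: (rf_zero N_ring).
have [W NW WV] := rf_add N_ring NV; have [W' NW' W'W] := IH W NW.
exists (W `&` W'); first exact: filterI.
move=> F FW; rewrite big_ord_recl; apply: WV; first by have [] := FW ord0.
by apply: W'W => i; have [] := FW (lift ord0 i).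
Qed.

Section MatrixFilter.
Variables (D : nzRingType) (n : nat) (N : set_system D).
Hypothesis N_ring : ring_filter (@GRing.mul D) N.

#[local] Instance matrix_base_filter : Filter N := rf_filter N_ring.

Definition entries_in (W : set D) : set 'M[D]_n := [set A | forall i j, W (A i j)].

Definition matrix_filter : set_system 'M[D]_n := filter_from N entries_in.

Lemma matrix_ring_filter : ring_filter (@mulmx D n n n) matrix_filter.
Proof.
split.
- apply: filter_from_filter; first by exists setT; exact: filterT.
  move=> V W NV NW; exists (V `&` W); first exact: filterI.
  by move=> A VWA; split=> i j; have [] := VWA i j.
- by move=> V [W NW]; apply=> i j; rewrite mxE; exact: (rf_zero N_ring).
- move=> V [W /(rf_sub N_ring) [W' NW' W'W] WV].
  exists (entries_in W'); first by exists W'.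
  by move=> A B WA WB; apply: WV => i j; rewrite !mxE; exact: W'W.
- move=> V [W /(ring_filter_sum n N_ring) [W' NW' W'W] WV].
  have [W2 NW2 W2W] := rf_mul N_ring NW'.
  exists (entries_in W2); first by exists W2.
  by move=> A B WA WB; apply: WV => i j; rewrite mxE; apply: W'W => k; exact: W2W.
- move=> A V [W /(ring_filter_sum n N_ring) [W' NW' W'W] WV].
  exists [set d | forall ik : 'I_n * 'I_n, W' (A ik.1 ik.2 * d)].
    by apply: filter_forall => ik; exact: (rf_mull N_ring _ NW').
  move=> B BW; apply: WV => i j; rewrite mxE; apply: W'W => k.
  exact: (BW k j (i, k)).
- move=> A V [W /(ring_filter_sum n N_ring) [W' NW' W'W] WV].
  exists [set d | forall kj : 'I_n * 'I_n, W' (d * A kj.1 kj.2)].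
    by apply: filter_forall => kj; exact: (rf_mulr N_ring _ NW').
  move=> B BW; apply: WV => i j; rewrite mxE; apply: W'W => k.
  exact: (BW i k (k, j)).
- move=> A AV; apply/matrixP => i j; rewrite mxE.
  apply: (rf_sep N_ring) => W NW.
  by apply: (AV (entries_in W)); exists W.
Qed.
End MatrixFilter.

Section ProductFilter.
Variables (R S : zmodType) (mulR : R -> R -> R) (mulS : S -> S -> S).
Variables (N : set_system R) (M : set_system S).
Hypotheses (N_ring : ring_filter mulR N) (M_ring : ring_filter mulS M).

#[local] Instance prod_left_filter : Filter N := rf_filter N_ring.
#[local] Instance prod_right_filter : Filter M := rf_filter M_ring.

Definition prod_mul (x y : R * S) : R * S := (mulR x.1 y.1, mulS x.2 y.2).

Lemma prod_ring_filter : ring_filter prod_mul (filter_prod N M).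
Proof.
split.
- exact: filter_prod_filter.
- move=> V [[A B] /= [NA MB] ABV]; apply: ABV.
  by split; [exact: (rf_zero N_ring) | exact: (rf_zero M_ring)].
- move=> V [[A B] /= [/(rf_sub N_ring) [A' NA' A'A] /(rf_sub M_ring) [B' MB' B'B]] ABV].
  exists (A' `*` B'); first by exists (A', B').
  by move=> x y [? ?] [? ?]; apply: ABV; split; [exact: A'A | exact: B'B].
- move=> V [[A B] /= [/(rf_mul N_ring) [A' NA' A'A] /(rf_mul M_ring) [B' MB' B'B]] ABV].
  exists (A' `*` B'); first by exists (A', B').
  by move=> x y [? ?] [? ?]; apply: ABV; split; [exact: A'A | exact: B'B].
- move=> a V [[A B] /= [NA MB] ABV].
  exists ([set x | A (mulR a.1 x)], [set x | B (mulS a.2 x)]).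
    by split; [exact: (rf_mull N_ring) | exact: (rf_mull M_ring)].
  by move=> x xAB; exact: ABV.
- move=> a V [[A B] /= [NA MB] ABV].
  exists ([set x | A (mulR x a.1)], [set x | B (mulS x a.2)]).
    by split; [exact: (rf_mulr N_ring) | exact: (rf_mulr M_ring)].
  by move=> x xAB; exact: ABV.
- move=> [x y] xyV; congr pair.
    apply: (rf_sep N_ring) => V NV; have [] // : (V `*` [set: S]) (x, y).
    by apply: xyV; exists (V, setT) => //; split => //; exact: filterT.
  apply: (rf_sep M_ring) => V MV; have [] // : ([set: R] `*` V) (x, y).
  by apply: xyV; exists (setT, V) => //; split => //; exact: filterT.
Qed.
End ProductFilter.

Section MatrixSummand.
Variables (R : rngType) (N : set_system R).
Hypothesis N_lc : linearly_compact_filter N.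
Variables (I : set R) (m : nat) (D : nzRingType) (f : 'M[D]_m.+1 -> R).
Hypotheses (I_summand : direct_summand I) (D_div : division_ring D).
Hypotheses (f_inj : injective f) (fI : range f = I)
  (fD : {morph f : A B / A + B}) (fM : {morph f : A B / A *m B >-> A ** B}).

Let N_ring := lcf_ring N_lc.
#[local] Instance summand_filter : Filter N := rf_filter N_ring.

Let c := f 1%:M.

Let f0 : f 0 = 0.
Proof. by apply: (addrI (f 0)); rewrite -fD !addr0. Qed.

Let fN A : f (- A) = - f A.
Proof. by apply: (addrI (f A)); rewrite -fD !subrr f0. Qed.

Let fB A B : f (A - B) = f A - f B.
Proof. by rewrite fD fN. Qed.

Let cf A : c ** f A = f A. Proof. by rewrite -fM mul1mx. Qed.
Let fc A : f A ** c = f A. Proof. by rewrite -fM mulmx1. Qed.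

(** The identity of a direct summand I is a central idempotent of R, and
    multiplication by it is the projection onto I. *)
Lemma summand_unit x : c ** x = x ** c /\ exists A, f A = c ** x.
Proof.
have [[[[_ _] Il] Ir] [J [[[[_ _] Jl] Jr] IJ IJs]]] := I_summand.
have Ic : I c by rewrite -fI; exists 1%:M.
have IJ0 z : I z -> J z -> z = 0 by move=> Iz Jz; have : (I `&` J) z by []; rewrite IJ.
have [i [j [Ii Jj ->]]] := IJs x.
have -> : c ** (i + j) = i.
  move: Ii; rewrite -fI => -[A _ <-]; rewrite rmulDr cf.
  by rewrite (IJ0 (c ** j)) ?addr0 //; [exact: Ir | exact: Jl].
move: Ii; rewrite -fI => -[A _ <-]; split; last by exists A.
by rewrite rmulDl fc (IJ0 (j ** c)) ?addr0 //; [exact: Il | exact: Jr].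
Qed.

Let c_central x : c ** x = x ** c. Proof. exact: (summand_unit x).1. Qed.
Let cc : c ** c = c. Proof. exact: cf. Qed.

Definition summand_coord (x : R) : 'M[D]_m.+1 := projT1 (cid (summand_unit x).2).
Local Notation g := summand_coord.

Lemma summand_coordK x : f (g x) = c ** x.
Proof. by rewrite /g; case: cid. Qed.

Lemma summand_coordB : {morph g : x y / x - y}.
Proof. by move=> x y; apply: f_inj; rewrite fB !summand_coordK rmulBr. Qed.

Lemma summand_coordM : {morph g : x y / x ** y >-> x *m y}.
Proof.
move=> x y; apply: f_inj; rewrite fM !summand_coordK.
by rewrite [c ** x]c_central -[x ** c ** _]rmulA [c ** (c ** y)]rmulA cc !rmulA c_central.
Qed.

Lemma summand_coord_f A : g (f A) = A.
Proof. by apply: f_inj; rewrite summand_coordK cf. Qed.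

Definition summand_split (x : R) : 'M[D]_m.+1 * R := (g x, x - c ** x).

Lemma summand_split_inj : injective summand_split.
Proof.
move=> x y [gxy]; rewrite -!summand_coordK gxy => /addIr; exact.
Qed.

(** Choose an open left ideal L without f (delta_mx 0 0).  The x with
    x f(delta_mx i 0) in L for all i form a neighbourhood of 0, and none of
    them has a nonzero coordinate: scaling that entry to 1 would put f (delta_mx 0 0) in L. *)
Lemma summand_discrete : N [set x | c ** x = 0].
Proof.
have E0 : delta_mx 0 0 != 0 :> 'M[D]_m.+1.
  apply/eqP => /matrixP /(_ 0 0); rewrite !mxE !eqxx /= => /eqP.
  by rewrite oner_eq0.
have [L [Ll NL Le]] : exists L, [/\ left_ideal L, N L & ~ L (f (delta_mx 0 0))].
  apply: contrapT => H; move/eqP: E0; apply; apply: f_inj; rewrite f0.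
  apply: (zero_of_open_ideals N_lc) => L Ll NL.
  by apply: contrapT => Le; apply: H; exists L.
have : N [set x | forall i, L (x ** f (delta_mx i 0))].
  by apply: filter_forall => i; exact: (rf_mulr N_ring).
apply: filterS => x xL; rewrite /= -summand_coordK.
suff -> : g x = 0 by [].
apply/matrixP => k i; rewrite [RHS]mxE; apply/eqP; apply/negPn/negP => gki.
have [d [_ dg]] := D_div gki; apply: Le.
have -> : delta_mx 0 0 = d *: delta_mx 0 k *m (g x *m delta_mx i 0) :> 'M[D]_m.+1.
  apply/matrixP => p q; rewrite !mxE (bigD1 k) //= big1 => [|l lk]; last first.
    by rewrite !mxE (negPf lk) andbF mulr0 mul0r.
  rewrite !mxE (bigD1 i) //= big1 => [|l li]; last first.
    by rewrite !mxE (negPf li) mulr0.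
  rewrite !mxE !eqxx !addr0 /=; case: (p == 0); case: (q == 0) => /=;
    by rewrite ?mulr1 ?mulr0 ?mul0r ?dg.
rewrite fM; apply: idealM => //.
by rewrite fM summand_coordK c_central -rmulA cf.
Qed.

(** The coarser topology is the one that R inherits from the product of the
    entrywise topology on the summand and of T on its complement. *)
Lemma matrix_summand_not_minimal : admits_nondiscrete_topology D ->
  exists N', [/\ ring_filter (@rmul R) N', N' `<=` N & N' <> N].
Proof.
move=> [TD [TD_haus TD_ring TD_nd]].
have ND_ring := ring_topology_filter (@mulrDl D) (@mulrDr D) TD_haus TD_ring.
pose N' := pullback_filter summand_split (filter_prod (matrix_filter (n := m.+1) (nbhs0 TD)) N).
exists N'; split.
- apply: (pullback_ring_filter _ _ _
    (prod_ring_filter (matrix_ring_filter m.+1 ND_ring) N_ring)).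
  + exact: summand_split_inj.
  + move=> x y; rewrite /summand_split summand_coordB rmulBr.
    by rewrite (_ : x - y - _ = x - c ** x - (y - c ** y)) // !opprD !opprK addrACA.
  + move=> x y; rewrite /summand_split summand_coordM /prod_mul /=; congr pair.
    have xcy : x ** (c ** y) = c ** (x ** y) by rewrite rmulA -c_central -rmulA.
    by rewrite [RHS]rmulBr !rmulBl -!rmulA xcy (rmulA c c) cc subrr subr0.
- move=> V [W [[A B] /= [[E NE EA] NB] ABW] WV].
  apply: filterS (filterI summand_discrete NB) => x [cx Bx].
  apply: WV; apply: ABW; split => /=; last by rewrite cx subr0.
  apply: EA => i j; have -> : g x = 0.
    by apply: f_inj; rewrite summand_coordK cx f0.
  by rewrite mxE; exact: (rf_zero ND_ring).
- move=> N'N; apply: TD_nd; apply/(discrete_nbhs0 TD_ring).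
  have := summand_discrete; rewrite -N'N => -[W [[A B] /= [[E NE EA] NB] ABW] Wc].
  have E0 := rf_zero ND_ring NE.
  apply: (@filterS _ _ (rf_filter ND_ring) E) NE => d Ed.
  have := Wc (f (d *: delta_mx 0 0)); rewrite /= cf => dE.
  have /matrixP /(_ 0 0) : d *: delta_mx 0 0 = 0 :> 'M[D]_m.+1.
    apply: f_inj; rewrite f0; apply: dE; apply: ABW; split => /=; last first.
      by rewrite cf subrr; exact: (rf_zero N_ring NB).
    apply: EA => i j; rewrite summand_coord_f !mxE.
    case: (_ && _); first by rewrite mulr1.
    by rewrite mulr0.
  by rewrite !mxE mulr1.
Qed.
End MatrixSummand.

(** * Minimal linearly compact semisimple rings *)

(** Open left ideals are closed, and so are their cosets. *)
Lemma linearly_compact_nbhs0 (R : rngType) (T : Topological R) :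
  ring_topology (@rmul R) T -> left_linearly_compact T ->
  linearly_compact_filter (nbhs0 T).
Proof.
move=> T_ring [T_haus T_lin T_lc].
have N_ring := ring_topology_filter (@rmulDl R) (@rmulDr R) T_haus T_ring.
split=> // I D x L DL fip.
pose coset i : set R := [set x i + y | y in L i].
pose F : set (set R) := [set C | exists2 i, D i & C = coset i].
have cosetP i z : L i (z - x i) -> coset i z.
  by move=> Lz; exists (z - x i) => //; rewrite addrC subrK.
have [||y yF] := T_lc F.
- move=> _ [i Di ->]; have [Ll NL] := DL i Di; split; last by exists (x i), (L i).
  move=> z; rewrite /closure /= => /(_ [set t | L i ((t : R) - z)]).
  case.
    apply/(topology_nbhs_shift T_ring); apply: (@filterS _ _ (rf_filter N_ring) (L i)) NL.
    by move=> l Li /=; rewrite addrAC subrr add0r.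
  move=> _ [[l Ll' <-]] /= Llz; apply: cosetP.
  have -> : (z : R) - x i = l - (x i + l - z).
    by rewrite opprB addrCA opprD [- _ - l]addrC addNKr.
  exact: idealB.
- move=> S SF.
  have [s [sD sS]] : exists s : seq I, (forall i, i \in s -> D i) /\
      forall C, C \in enum_fset S -> exists2 i, i \in s & C = coset i.
    have : forall C, C \in enum_fset S -> exists2 i, D i & C = coset i.
      by move=> C CS; have := SF C CS; rewrite inE.
    move: (enum_fset S) => t; elim: t => [|C S' IH] CF; first by exists [::].
    have [|s [sD sS]] := IH.
      by move=> C' C'S; apply: CF; rewrite inE C'S orbT.
    have [i Di Ci] := CF C (mem_head _ _).
    exists (i :: s); split.
      by move=> j; rewrite inE => /orP[/eqP->|/sD].
    move=> C'; rewrite inE => /orP[/eqP->|/sS [j js ->]].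
      by exists i => //; rewrite inE eqxx.
    by exists j => //; rewrite inE js orbT.
  have [y ys] := fip s sD; exists y => C /sS [i si ->].
  by apply: cosetP; exact: ys.
exists y => i Di; have [|l Ll <-] := yF (coset i); first by exists i.
by rewrite addrAC subrr add0r.
Qed.

Theorem corollary3 (R : rngType) (T : Topological R)
    (T_ring : ring_topology (@rmul R) T)
    (T_llc : left_linearly_compact T)
    (R_ss : semisimple R) :
  minimal_ring_topology T <->
  ~ (exists (I : set R) (n : nat) (D : nzRingType),
       [/\ direct_summand I, (0 < n)%N, division_ring D,
           isomorphic_to_matrix_ring I n D & admits_nondiscrete_topology D]).
Proof.
have N_lc := linearly_compact_nbhs0 T_ring T_llc.
split.
  move=> Tmin [I [[|m] [D [//= I_summand _ D_div [f [f_inj fI fD fM]] D_top]]]].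
  have [N' [N'_ring N'N N'neq]] :=
    matrix_summand_not_minimal N_lc I_summand D_div f_inj fI fD fM D_top.
  have [U [U_haus U_ring UE]] := ring_filter_topology (@rmulDl R) (@rmulDr R) N'_ring.
  apply: N'neq; rewrite -UE; apply/(same_topology_nbhs0 T_ring U_ring).
  by apply: Tmin => //; apply/(coarser_nbhs0 T_ring U_ring); rewrite UE.
move=> no_summand U U_haus U_ring /(coarser_nbhs0 T_ring U_ring) UT.
apply/(same_topology_nbhs0 T_ring U_ring); apply/seteqP; split=> //.
apply: (linearly_compact_minimal N_lc R_ss _ UT no_summand).
exact: (ring_topology_filter (@rmulDl R) (@rmulDr R) U_haus U_ring).
Qed.
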